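(* Let $\mathbb F_p$ denote a field of characteristic $p$. Then $$H_*(R^+;\mathbb F_0)=\bigoplus_{w\in W}H_*^{w*\varrho}(R^+;\mathbb F_0)=\bigoplus_{w\in W}\Lambda(w*\varrho)\otimes\mathbb F_0,$$ $$H^*(R^+;\mathbb F_0)=\bigoplus_{w\in W}H^*_{w*\varrho}(R^+;\mathbb F_0)=\bigoplus_{w\in W}\Lambda(w*\varrho)\otimes\mathbb F_0.$$ For a prime $p$ and $\alpha\in\Omega(R^+)$, if $r(\alpha)\not\equiv0\bmod p$, then $$H_*^\alpha(R^+;\mathbb F_p)=0,\qquad H^*_\alpha(R^+;\mathbb F_p)=0.$$
   Context: $R^+$ is the positive root system of a semisimple Lie algebra over $\mathbb C$, $V$ is the real vector space spanned by $R^+$, and $W$ is the Weyl group acting on $V$, the action being written $w*v$. The free abelian group on $R^+$ carries the Lie algebra structure over $\mathbb Z$ of the positive root system, with bracket of basis elements $[e,e']=\pm(e+e')$ (meaning $\pm$ the basis element $e+e'$) if $e+e'\in R^+$, and $[e,e']=0$ otherwise. $\Lambda(R^+)$ is the exterior algebra over $\mathbb Z$ on generators $(e)$, $e\in R^+$, graded by $|(e_1)\cdots(e_n)|=n$, $|1|=0$. The chain complex $(\Lambda(R^+),d)$ has $d(e)=0$ for $e\in R^+$ and, for $n>1$, $$d((e_1)\cdots(e_n))=\sum_{i<j}(-1)^{j-i-1}([e_i,e_j])(e_1)\cdots\widehat{(e_i)}\cdots\widehat{(e_j)}\cdots(e_n),$$ where hats denote omission, $(-e)=-(e)$ and $(0)=0$.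 Fix a total order on $R^+$ and identify $\sigma\subseteq R^+$ with the ordered product $\prod_{e\in\sigma}(e)\in\Lambda(R^+)$ ($\emptyset$ with $1$); these form a $\mathbb Z$-basis. $(\Lambda(R^+),\delta)$ is the dual cochain complex, regarded as the same group with the dual differential $\delta$ (the transpose of $d$ in this basis). $H_*(R^+;\mathbb F)=H_*(\Lambda(R^+)\otimes\mathbb F,d)$, $H^*(R^+;\mathbb F)=H^*(\Lambda(R^+)\otimes\mathbb F,\delta)$. Basis graph $\Gamma(R^+)$: its vertices are all subsets of $R^+$; $\{\sigma,\tau\}$ is an edge iff there are $e,e_1,e_2\in R^+$ with $e=e_1+e_2$ such that either $\sigma\setminus\tau=\{e\}$ and $\tau\setminus\sigma=\{e_1,e_2\}$, or $\tau\setminus\sigma=\{e\}$ and $\sigma\setminus\tau=\{e_1,e_2\}$. Weight: $\omega(\sigma)=\varrho-\sum_{e\in\sigma}e$ with $\varrho=\frac12\sum_{e\in R^+}e$; $\Omega(R^+)=\{\omega(\sigma)\mid\sigma\subseteq R^+\}$; $\Gamma(\alpha)$ is the full subgraph of $\Gamma(R^+)$ on $\omega^{-1}(\alpha)$. The paper shows that $\Gamma(\alpha)$ is connected and all its vertices have the same number of neighbors in $\Gamma(\alpha)$; the rank $r(\alpha)$ is this common number. $\Lambda(\alpha)$ is the subgroup of $\Lambda(R^+)$ freely generated by the vertices of $\Gamma(\alpha)$, a subcomplex for both $d$ and $\delta$; $H_*^\alpha(R^+;\mathbb F)=H_*(\Lambda(\alpha)\otimes\mathbb F,d)$, $H^*_\alpha(R^+;\mathbb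 F)=H^*(\Lambda(\alpha)\otimes\mathbb F,\delta)$. *)

(* Defs.v *)
From HB Require Import structures.
From mathcomp Require Import all_boot all_order all_algebra.
From mathcomp Require Import boolp reals.

Set Implicit Arguments.
Unset Strict Implicit.
Unset Printing Implicit Defensive.

Import Order.TTheory GRing.Theory Num.Theory.
Local Open Scope ring_scope.

(* Reduced crystallographic root systems, i.e. the root systems of complex
   semisimple Lie algebras.  [roots] lists the finite set of roots, in any order
   and possibly with repetitions. *)
Record rootSystem (R : realType) (V : vectType R) := RootSystem {
  dot : V -> V -> R;
  dotC : forall u v, dot u v = dot v u;
  dotD : forall u v w, dot (u + v) w = dot u w + dot v w;
  dotZ : forall c u v, dot (c *: u) v = c * dot u v;
  dot_gt0 : forall v, v != 0 -> 0 < dot v v;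
  roots : seq V;
  roots_span : <<roots>>%VS = fullv;
  roots_neq0 : 0 \notin roots;
  roots_refl : forall a b, a \in roots -> b \in roots ->
    b - (2 * dot b a / dot a a) *: a \in roots;
  roots_int : forall a b, a \in roots -> b \in roots ->
    2 * dot b a / dot a a \is a Num.int;
  roots_reduced : forall a (c : R), a \in roots -> c *: a \in roots ->
    c = 1 \/ c = -1
}.

(* The positive roots, listed as [proot i] without repetition; the order of the
   indices i : 'I_npos is the fixed total order on the positive roots. *)
Record positiveSystem (R : realType) (V : vectType R) (S : rootSystem V) :=
  PositiveSystem {
  npos : nat;
  proot : 'I_npos -> V;
  proot_inj : injective proot;
  proot_pos : exists f : 'Hom(V, R^o),
    (forall a, a \in roots S -> f a != 0) /\
    (forall a, (exists i, a = proot i) <-> (a \in roots S /\ 0 < f a))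
}.

Section Weyl.
Variables (R : realType) (V : vectType R) (S : rootSystem V).

Definition refl_fun (a v : V) : V := v - (2 * dot S v a / dot S a a) *: a.

Lemma refl_fun_is_linear a : linear (refl_fun a).
Proof.
move=> c u v; rewrite /refl_fun dotD dotZ.
have -> : 2 * (c * dot S u a + dot S v a) / dot S a a =
    c * (2 * dot S u a / dot S a a) + 2 * dot S v a / dot S a a.
  by rewrite mulrDr mulrDl mulrCA -!mulrA.
by rewrite scalerDl opprD scalerBr scalerA addrACA.
Qed.
HB.instance Definition _ a :=
  GRing.isLinear.Build R V V _ (refl_fun a) (refl_fun_is_linear a).

Definition refl (a : V) : 'End(V) := linfun (refl_fun a).

(* The Weyl group; reflections being involutions, the monoid they generate is
   a group. *)
Inductive weyl : 'End(V) -> Prop :=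
| weyl_one : weyl \1%VF
| weyl_refl a w : a \in roots S -> weyl w -> weyl (refl a \o w)%VF.

Lemma weyl_root w a : weyl w -> a \in roots S -> w a \in roots S.
Proof.
move=> ww; elim: ww a => [a|b w' rb _ IH a] ra; first by rewrite id_lfunE.
by rewrite comp_lfunE lfunE /= roots_refl ?IH.
Qed.

Lemma weyl_finite :
  exists W : seq 'End(V), uniq W /\ forall f, (f \in W) <-> weyl f.
Proof.
pose T : finType := seq_sub (roots S).
pose Q (g : {ffun T -> T}) f := weyl f /\ forall u : T, f (val u) = val (g u).
pose F g := if pselect (exists f, Q g f) is left h then Some (projT1 (cid h))
            else None.
exists (undup (pmap F (enum {ffun T -> T}))); split; first exact: undup_uniq.
move=> f; rewrite mem_undup; split.
  rewrite mem_pmap => /mapP[g _]; rewrite /F.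
  by case: pselect => // h [->]; case: (cid h) => f' [].
move=> wf; pose g := [ffun u : T => SeqSub (weyl_root wf (valP u))].
rewrite mem_pmap; apply/mapP; exists g; first by rewrite mem_enum.
rewrite /F; case: pselect => [h|[]]; last first.
  by exists f; split=> // u; rewrite ffunE.
congr Some; case: (cid h) => f' [_ Hf'] /=.
apply/lfunP => v; have : v \in <<in_tuple (roots S)>>%VS.
  by rewrite /= roots_span memvf.
move/coord_span=> ->; rewrite !linear_sum; apply: eq_bigr => i _.
rewrite !linearZ; congr (_ *: _).
have ri : (roots S)`_i \in roots S by rewrite mem_nth.
by have := Hf' (SeqSub ri); rewrite ffunE.
Qed.

Definition weyl_enum : seq 'End(V) := projT1 (cid weyl_finite).

Lemma weyl_enum_uniq : uniq weyl_enum.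
Proof. by rewrite /weyl_enum; case: cid => W []. Qed.

Lemma weyl_enumP f : (f \in weyl_enum) <-> weyl f.
Proof. by rewrite /weyl_enum; case: cid => W []. Qed.

Definition weylGroup : finType := seq_sub weyl_enum.

Definition weyl_act (w : weylGroup) (v : V) : V := (val w : 'End(V)) v.

End Weyl.

Section BasisGraph.
Variables (R : realType) (V : vectType R) (S : rootSystem V).
Variable P : positiveSystem S.
Local Notation N := (npos P).
Local Notation e_ := (@proot _ _ _ P).
Implicit Types (s t : {set 'I_N}) (alpha : V).

Definition rho : V := 2^-1 *: \sum_(i < N) e_ i.

Definition weight s : V := rho - \sum_(i in s) e_ i.

Definition basis_edge s t : bool :=
  [exists i, exists j, exists k,
     (e_ i == e_ j + e_ k) &&
     ((s :\: t == [set i]) && (t :\: s == [set j; k])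
      || (t :\: s == [set i]) && (s :\: t == [set j; k]))].

Definition degree alpha s : nat :=
  #|[set t | (weight t == alpha) && basis_edge s t]|.

(* The common degree of the vertices of Gamma(alpha), read off on an arbitrary
   vertex; 0 by convention if alpha is not a weight. *)
Definition rank alpha : nat :=
  if [pick s | weight s == alpha] is Some s then degree alpha s else 0.

End BasisGraph.

Definition freeZ (N : nat) := {ffun 'I_N -> int}.

Definition gen N (i : 'I_N) : freeZ N := [ffun k => (k == i)%:R].

(* The signs in [e, e'] = +- (e + e') are part of the data, constrained by the
   Lie algebra axioms.  Not every root system admits such signs: for type C_3 the
   Jacobi identity can have three nonzero terms. *)
Record rootLie (R : realType) (V : vectType R) (S : rootSystem V)
    (P : positiveSystem S) := RootLie {
  lbr : freeZ (npos P) -> freeZ (npos P) -> freeZ (npos P);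
  lbrDl : forall x y z, lbr (x + y) z = lbr x z + lbr y z;
  lbrDr : forall x y z, lbr x (y + z) = lbr x y + lbr x z;
  lbrxx : forall x, lbr x x = 0;
  lbr_jacobi : forall x y z,
    lbr x (lbr y z) + lbr y (lbr z x) + lbr z (lbr x y) = 0;
  lbr_root : forall i j k, proot k = proot i + proot j ->
    lbr (gen i) (gen j) = gen k \/ lbr (gen i) (gen j) = - gen k;
  lbr_nonroot : forall i j,
    (forall k : 'I_(npos P), proot k != proot i + proot j) ->
    lbr (gen i) (gen j) = 0
}.

Section Exterior.
Variable N : nat.
Implicit Types (s t : {set 'I_N}).

(* An element of the exterior algebra is given by its coordinates in the basis
   of ordered products indexed by the subsets. *)
Definition ext := {ffun {set 'I_N} -> int^o}.

Definition ext_basis s : ext := [ffun t => (t == s)%:R].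

(* Left multiplication by (x) for x in the free group of generators: moving (k)
   to its place in the ordered product t costs one sign for each element of t
   smaller than k. *)
Definition ext_mul (x : freeZ N) (u : ext) : ext :=
  [ffun t : {set 'I_N} => \sum_(k in t)
     (-1) ^+ #|[set m in t | (m < k)%N]| * x k * u (t :\ k)].

Definition ext_prod (l : seq 'I_N) : ext :=
  foldr (fun k => ext_mul (gen k)) (ext_basis set0) l.

Lemma ext_mul_gen k s :
  ext_mul (gen k) (ext_basis s) =
  if k \in s then 0
  else (-1) ^+ #|[set m in s | (m < k)%N]| *: ext_basis (k |: s).
Proof.
apply/ffunP => t; rewrite ffunE.
have E m r : gen k m * ext_basis s r = if (m == k) && (r == s) then 1 else 0.
  by rewrite !ffunE -natrM mulnb; case: ifP.
have [ks|ks] := boolP (k \in s).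
  rewrite ffunE big1 // => m mt; rewrite -mulrA E.
  case: ifP => [/andP[/eqP-> /eqP]|_]; last by rewrite mulr0.
  by move=> H; move: ks; rewrite -H setD11.
rewrite [RHS]ffunE [X in _ = _ *: X]ffunE.
have [->|nts] := eqVneq t (k |: s); last first.
  rewrite scaler0 big1 // => m mt; rewrite -mulrA E.
  case: ifP => [/andP[/eqP mk /eqP H]|_]; last by rewrite mulr0.
  by case/eqP: nts; rewrite -H -mk setD1K.
rewrite (bigD1 k) ?setU11 //= big1 => [|m /andP[_ mk]]; last first.
  by rewrite -mulrA E (negPf mk) mulr0.
rewrite addr0 -mulrA E eqxx setU1K // eqxx; congr (_ ^+ _ * _).
apply: eq_card => m; rewrite !inE; have [->|//] := eqVneq m k.
by rewrite ltnn !andbF.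
Qed.

Variable br : freeZ N -> freeZ N -> freeZ N.

(* d((e_1)...(e_n)) for the product of the generators listed in l. *)
Definition d_prod n (l : n.-tuple 'I_N) : ext :=
  \sum_(j < n) \sum_(i < n | (i < j)%N)
    (-1) ^+ (j - i - 1) *:
    ext_mul (br (gen (tnth l i)) (gen (tnth l j)))
      (ext_prod [seq tnth l k | k <- enum 'I_n & (k != i) && (k != j)]).

(* [enum s] lists s increasingly; [dcoef s t] is the coefficient of t in d s. *)
Definition dcoef s t : int := d_prod (in_tuple (enum s)) t.

End Exterior.

(* The ordered product of the elements of s is the basis element s. *)
Lemma ext_prod_enum N (s : {set 'I_N}) : ext_prod (enum s) = ext_basis s.
Proof.
have : sorted (fun i j : 'I_N => (i < j)%N) (enum s).
  rewrite -[enum s](eq_filter (a1 := mem s)) //.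
  apply: sorted_filter; first by move=> i j k; apply: ltn_trans.
  have := iota_ltn_sorted 0 N; rewrite -val_enum_ord sorted_map.
  by rewrite enumT.
rewrite -[in RHS](set_enum s); have := enum_uniq s.
elim: (enum s) => [_ _|k l IH /= /andP[kl ul] pl].
  by rewrite /ext_prod /=; congr ext_basis; apply/setP => i; rewrite !inE.
have tr : transitive (fun i j : 'I_N => (i < j)%N).
  by move=> i j m; apply: ltn_trans.
rewrite -/(ext_prod l) IH //; last exact: path_sorted pl.
rewrite ext_mul_gen inE (negPf kl).
rewrite (_ : [set _ in _ | _] = set0) ?cards0 ?expr0 ?scale1r.
  by congr ext_basis; apply/setP => i; rewrite !inE.
apply/setP => m; rewrite !inE; apply/negbTE/negP => /andP[ml].
by have /allP/(_ m ml) /= km := order_path_min tr pl; rewrite ltnNge ltnW.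
Qed.

Section Subquotient.
Variables (K : fieldType) (A : vectType K).
Implicit Types (Z B : {vspace A}).

(* The quotient A / B is realized on a complement of B: [quot_proj B] is the
   quotient map, since its kernel is B. *)
Definition quot_proj B : 'End(A) := daddv_pi B^C B.

Lemma lker_quot_proj B : lker (quot_proj B) = B.
Proof.
have D : (B^C :&: B = 0)%VS by rewrite capvC capv_compl.
apply/vspaceP => v; rewrite memv_ker /quot_proj; apply/eqP/idP => [v0|vB].
  have vS : v \in (B^C + B)%VS by rewrite addvC addv_complf memvf.
  by rewrite -(daddv_pi_add D vS) v0 add0r memv_pi.
have vS : v \in (B^C + B)%VS by rewrite addvC addv_complf memvf.
have := daddv_pi_add D vS; rewrite [X in _ + X]daddv_pi_id //; last first.
  by rewrite capv_compl.
by move/(canRL (addrK v)); rewrite subrr.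
Qed.

(* Z / (Z :&: B), that is Z / B when B is contained in Z (for cycles and
   boundaries this containment is d^2 = 0). *)
Definition subquot Z B : {vspace A} := (quot_proj B @: Z)%VS.

(* The class of an element of Z (junk outside Z + B). *)
Definition sqclass Z B : 'Hom(A, subvs_of (subquot Z B)) :=
  linfun (vsproj (subquot Z B) \o quot_proj B).

(* The map induced by the inclusions of Z in Z' and of B in B'. *)
Definition sqmap Z B Z' B' :
    'Hom(subvs_of (subquot Z B), subvs_of (subquot Z' B')) :=
  linfun (sqclass Z' B' \o vsval).

Lemma sqclass_eq0 Z B z : z \in Z -> (sqclass Z B z == 0) = (z \in B).
Proof.
move=> zZ; rewrite lfunE /= -[in RHS](lker_quot_proj B) memv_ker.
by rewrite -(inj_eq val_inj) /= [val (vsproj _ _)]vsprojK ?memv_img.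
Qed.

Lemma sqclass_surj Z B (h : subvs_of (subquot Z B)) :
  exists2 z, z \in Z & h = sqclass Z B z.
Proof.
have /memv_imgP[z zZ hz] := subvsP h; exists z => //.
by apply: val_inj; rewrite lfunE /= vsprojK // memv_img.
Qed.

Lemma sqmap_class Z B Z' B' z : (Z <= Z')%VS -> (B <= B')%VS -> z \in Z ->
  sqmap Z B Z' B' (sqclass Z B z) = sqclass Z' B' z.
Proof.
move=> ZZ' BB' zZ; rewrite lfunE /= [sqclass Z B z]lfunE /= vsprojK ?memv_img //.
rewrite !lfunE /=; congr vsproj; apply/eqP.
rewrite -subr_eq0 -linearB -memv_ker lker_quot_proj; apply: (subvP BB').
suff : quot_proj B z - z \in lker (quot_proj B) by rewrite lker_quot_proj.
rewrite memv_ker linearB /= subr_eq0; apply/eqP.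
by rewrite [LHS]daddv_pi_id ?memv_pi // capvC capv_compl.
Qed.

End Subquotient.

(* A is the direct sum of the U i via the maps f i. *)
Definition direct_sum (K : fieldType) (I : finType) (U : I -> vectType K)
    (A : vectType K) (f : forall i, 'Hom(U i, A)) : Prop :=
  [/\ forall i, lker (f i) = 0%VS,
      directv (\sum_i limg (f i))%VS
    & (\sum_i limg (f i))%VS = fullv].

Definition iso (K : fieldType) (A B : vectType K) (f : 'Hom(A, B)) : Prop :=
  lker f = 0%VS /\ limg f = fullv.

Section Homology.
Variables (R : realType) (V : vectType R) (S : rootSystem V).
Variables (P : positiveSystem S) (L : rootLie P) (F : fieldType).
Local Notation N := (npos P).
Implicit Types (A B : {pred V}) (D : pred nat) (n : nat).

(* The exterior algebra tensored with F, in the coordinates of its basis. *)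
Definition chain : vectType F := {ffun {set 'I_N} -> F^o}.

Definition chain_basis (s : {set 'I_N}) : chain := [ffun t => (t == s)%:R].

Definition diff_fun (u : chain) : chain :=
  [ffun t => \sum_s u s * (dcoef (lbr L) s t)%:~R].

Definition codiff_fun (u : chain) : chain :=
  [ffun s => \sum_t u t * (dcoef (lbr L) s t)%:~R].

Lemma diff_fun_is_linear : linear diff_fun.
Proof.
move=> c u v; apply/ffunP => t; rewrite !ffunE scaler_sumr -big_split /=.
by apply: eq_bigr => s _; rewrite !ffunE mulrDl -scalerAl.
Qed.
HB.instance Definition _ :=
  GRing.isLinear.Build F chain chain _ diff_fun diff_fun_is_linear.

Lemma codiff_fun_is_linear : linear codiff_fun.
Proof.
move=> c u v; apply/ffunP => t; rewrite !ffunE scaler_sumr -big_split /=.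
by apply: eq_bigr => s _; rewrite !ffunE mulrDl -scalerAl.
Qed.
HB.instance Definition _ :=
  GRing.isLinear.Build F chain chain _ codiff_fun codiff_fun_is_linear.

Definition diff : 'End(chain) := linfun diff_fun.
Definition codiff : 'End(chain) := linfun codiff_fun.

(* Spanned by the subsets with weight in A and cardinality in D.  The whole
   complex is obtained for A = predT and Lambda(alpha) for A = pred1 alpha. *)
Definition chains A D : {vspace chain} :=
  <<[seq chain_basis s |
      s in [pred s : {set 'I_N} | (weight s \in A) && D #|s|]]>>%VS.

Definition cycles A n := (chains A (pred1 n) :&: lker diff)%VS.
Definition boundaries A n := (diff @: chains A (pred1 n.+1))%VS.
Definition homology A n : vectType F :=
  subvs_of (subquot (cycles A n) (boundaries A n)).

Definition cocycles A n := (chains A (pred1 n) :&: lker codiff)%VS.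
Definition coboundaries A n :=
  (codiff @: chains A (fun m => m.+1 == n))%VS.
Definition cohomology A n : vectType F :=
  subvs_of (subquot (cocycles A n) (coboundaries A n)).

(* The maps induced by the inclusion of Lambda(alpha) in the whole complex. *)
Definition homology_incl (alpha : V) n :
    'Hom(homology (pred1 alpha) n, homology predT n) :=
  sqmap _ _ _ _.
Definition cohomology_incl (alpha : V) n :
    'Hom(cohomology (pred1 alpha) n, cohomology predT n) :=
  sqmap _ _ _ _.

(* The class maps on the chains of Lambda(alpha), meaningful when all these
   chains are cycles, resp. cocycles. *)
Definition homology_class (alpha : V) n :
    'Hom(subvs_of (chains (pred1 alpha) (pred1 n)), homology (pred1 alpha) n) :=
  linfun (sqclass (cycles (pred1 alpha) n) (boundaries (pred1 alpha) n)
          \o vsval).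
Definition cohomology_class (alpha : V) n :
    'Hom(subvs_of (chains (pred1 alpha) (pred1 n)), cohomology (pred1 alpha) n) :=
  linfun (sqclass (cocycles (pred1 alpha) n) (coboundaries (pred1 alpha) n)
          \o vsval).

End Homology.

(* Main.v *)
(* The structure constants being +-1, a Jacobi identity never has exactly one or
   three nonzero terms.  Together with the fact that two positive roots with
   positive inner product differ by a root, this makes all off-diagonal entries
   of the Laplacian d delta + delta d vanish: normally ordered in creation and
   annihilation operators, its quartic coefficients are Jacobi expressions.  The
   diagonal entry at a set s is its number deg s of neighbours in the basis
   graph, and it is constant along edges because d d = 0.  Hence the weight
   alpha contributes no homology when deg is invertible on it.

   If deg s = 0, then s is closed and coclosed; reflecting in a simple root of s
   shortens s, so the weight of s lies in the orbit of rho.  Conversely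
   w rho = weight s forces s to be the set of positive roots made negative by
   the inverse of w, whence deg s = 0 and d, delta vanish on Lambda(w rho).
   Finally w |-> w rho is injective, by the exchange property. *)

(* The quartic part of the Laplacian matters only up to antisymmetry in the two removed and in the
   two added indices. The antisymmetrized coefficient [curv] has one direct term (x, y fuse and
   split again into z, w) and four crossed terms (one removed root hands a root over to the other).
   The obstacle is to show, for disjoint pairs, that either all five vanish or exactly two survive
   and cancel by a two-term Jacobi identity; a third survivor would spoil this, and [no_triangle]
   excludes it. Constancy of deg along edges does not yet settle the statement mod p, where the rank
   is read off an arbitrary vertex. Sets of equal weight are therefore brought together along edges,
   by an exchange argument on their symmetric difference. The operator identities carry factors such
   as 2, 4 and 6. These are cancelled over the integers, entry by entry, before passing to a field,
   so characteristics 2 and 3 are covered as well. *)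
From HB Require Import structures.
Require Import Defs.
From mathcomp Require Import all_boot all_order all_algebra.
From mathcomp Require Import boolp reals.
From mathcomp Require Import ring lra zify.

Set Implicit Arguments.
Unset Strict Implicit.
Unset Printing Implicit Defensive.

Import Order.TTheory GRing.Theory Num.Theory.
Local Open Scope ring_scope.

(* fingraph also defines [roots]. *)
Local Notation roots := Defs.roots.

(** * Bookkeeping for sums over triples of indices *)

Section TripleSums.
Variables (I : finType) (X : zmodType).
Implicit Types F G : I -> I -> I -> X.

Definition sum3 F := \sum_i \sum_j \sum_l F i j l.

Lemma eq_sum3 F G : (forall i j l, F i j l = G i j l) -> sum3 F = sum3 G.
Proof.
by move=> FG; do 3![apply: eq_bigr => ? _]; apply: FG.
Qed.

Lemma sum3D F G : sum3 (fun i j l => F i j l + G i j l) = sum3 F + sum3 G.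
Proof.
rewrite -big_split; apply: eq_bigr => i _; rewrite -big_split.
by apply: eq_bigr => j _; rewrite -big_split.
Qed.

Lemma sum3N F : sum3 (fun i j l => - F i j l) = - sum3 F.
Proof. by rewrite /sum3; do 3![rewrite -sumrN; apply: eq_bigr => ? _]. Qed.

Lemma sum3B F G : sum3 (fun i j l => F i j l - G i j l) = sum3 F - sum3 G.
Proof. by rewrite sum3D sum3N. Qed.

Lemma sum3Mn F n : sum3 (fun i j l => F i j l *+ n) = sum3 F *+ n.
Proof. by rewrite /sum3; do 3![rewrite -sumrMnl; apply: eq_bigr => ? _]. Qed.

Lemma sum3_swap12 F : sum3 F = sum3 (fun i j l => F j i l).
Proof. exact: exchange_big. Qed.

Lemma sum3_swap23 F : sum3 F = sum3 (fun i j l => F i l j).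
Proof. by apply: eq_bigr => i _; apply: exchange_big. Qed.

Lemma raddf_sum3 (f : {additive X -> X}) F :
  f (sum3 F) = sum3 (fun i j l => f (F i j l)).
Proof. by rewrite /sum3; do 3![rewrite raddf_sum; apply: eq_bigr => ? _]. Qed.

Lemma sum3_exch (H : I -> I -> I -> I -> X) :
  \sum_k sum3 (H k) = sum3 (fun i j l => \sum_k H k i j l).
Proof.
rewrite /sum3 exchange_big; apply: eq_bigr => i _.
by rewrite exchange_big; apply: eq_bigr => j _; rewrite exchange_big.
Qed.

End TripleSums.

(** * Fermionic operators *)

Section Fermions.
Variables (I : finType) (X : zmodType) (E a : I -> {additive X -> X}).
Hypothesis EE : forall i j v, E i (E j v) = - E j (E i v).
Hypothesis aa : forall i j v, a i (a j v) = - a j (a i v).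
Hypothesis aE : forall i j v, a i (E j v) = v *+ (i == j) - E j (a i v).
Variable c : I -> I -> I -> int.
Hypothesis c_skew : forall i j k, c j i k = - c i j k.

(* Ordered pairs i, j are summed, so [ce_d] and [ce_delta] are twice the
   Chevalley-Eilenberg operators; this avoids dividing by 2 over the integers. *)
Definition ce_d v := sum3 (fun i j l => E l (a j (a i v)) *~ c i j l).
Definition ce_delta v := sum3 (fun i j l => E i (E j (a l v)) *~ c i j l).
(** [ce_ad k] is the derivation extending ad(e_k): one factor j is replaced by [k, j]. [ce_coad k]
    contracts two factors i, j with the coefficient of k in [i, j]. They are what remains when
    [ce_d] is moved past [E k] and [a k]. *)
Definition ce_ad k v := \sum_j \sum_l E l (a j v) *~ c k j l.
Definition ce_coad k v := \sum_i \sum_j a j (a i v) *~ c i j k.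

Lemma sum_delta (k : I) (F : I -> X) : \sum_i F i *+ (i == k) = F k.
Proof.
rewrite (bigD1 k) //= eqxx big1 ?addr0 // => i /negPf->.
by rewrite mulr0n.
Qed.

Lemma ce_d_is_additive : zmod_morphism ce_d.
Proof.
move=> u v; rewrite /ce_d -sum3B; apply: eq_sum3 => i j l.
by rewrite !raddfB mulrzBl.
Qed.

HB.instance Definition _ := GRing.isZmodMorphism.Build X X ce_d ce_d_is_additive.

Lemma aaE i j k v : a j (a i (E k v)) =
  a j v *+ (i == k) - a i v *+ (j == k) + E k (a j (a i v)).
Proof.
rewrite aE raddfB raddfMn /= aE opprB -addrA; congr (_ + _).
by rewrite addrC.
Qed.

(** Moving [E k] out past the two annihilators leaves a contraction with each; skew symmetry of [c]
    makes the two equal, whence the factor 2. This is Cartan's formula for the doubled operator. *)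
Lemma ce_dE k v : ce_d (E k v) = ce_ad k v *+ 2 - E k (ce_d v).
Proof.
rewrite /ce_d raddf_sum3 -sum3N.
pose G1 i j l := (E l (a j v) *~ c i j l) *+ (i == k).
pose G2 i j l := (E l (a i v) *~ c i j l) *+ (j == k).
transitivity (sum3 (fun i j l => G1 i j l - G2 i j l -
    E k (E l (a j (a i v)) *~ c i j l))).
  apply: eq_sum3 => i j l; rewrite aaE raddfD raddfB /= !raddfMn /= EE.
  rewrite !mulrzDl raddfMz /= /G1 /G2 !mulNrz.
  by case: (i == k); case: (j == k);
    rewrite ?mulr1n ?mulr0n ?oppr0 ?mul0rz ?mulNrz.
rewrite sum3B sum3B sum3N; congr (_ - _).
have -> : sum3 G1 = ce_ad k v.
  rewrite /sum3 /G1 exchange_big; apply: eq_bigr => j _.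
  rewrite exchange_big; apply: eq_bigr => l _; exact: sum_delta.
have -> : sum3 G2 = - ce_ad k v.
  rewrite /sum3 /G2 /ce_ad -sumrN; apply: eq_bigr => i _.
  rewrite exchange_big -sumrN; apply: eq_bigr => l _; rewrite sum_delta.
  by rewrite c_skew mulrNz.
by rewrite opprK mulr2n.
Qed.

Lemma aaa i j k v : a i (a j (a k v)) = a j (a k (a i v)).
Proof. by rewrite aa [a i _]aa raddfN /= opprK. Qed.

Lemma ce_da p v : ce_d (a p v) = ce_coad p v - a p (ce_d v).
Proof.
rewrite /ce_d raddf_sum3 -sum3N.
pose G i j l := (a j (a i v) *~ c i j l) *+ (l == p).
transitivity (sum3 (fun i j l => G i j l - a p (E l (a j (a i v)) *~ c i j l))).
  apply: eq_sum3 => i j l; rewrite raddfMz /= aE.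
  rewrite mulrzBl eq_sym /G !pmulrn (mulrzAC _ (Posz _)).
  by rewrite aaa aaa opprB addrC subrK.
rewrite sum3B sum3N; congr (_ - _).
rewrite /sum3 /G /ce_coad; apply: eq_bigr => i _; apply: eq_bigr => j _.
exact: sum_delta.
Qed.

Hypothesis c_jacobi : forall x y z w,
  \sum_l (c y z l * c x l w + c z x l * c y l w + c x y l * c z l w) = 0.

(** The coefficient of m in [[i, j], k]. The square of [ce_d] will reduce to a multiple of [Q]. *)
Let cE i j k m := \sum_l c i j l * c l k m.

Let Q v := sum3 (fun i j k => \sum_m E m (a k (a j (a i v))) *~ cE i j k m).

(** A product of three annihilators is unchanged by cyclic rotation, so adding the three rotated
    forms of [Q] collects a Jacobi sum in each coefficient. *)
Lemma ce_d_jacobi v : Q v *+ 3 = 0.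
Proof.
pose F i j k := \sum_m E m (a k (a j (a i v))) *~ cE i j k m.
have F1 : Q v = sum3 (fun i j k => F j k i).
  by rewrite /Q sum3_swap23 sum3_swap12.
have F2 : Q v = sum3 (fun i j k => F k i j).
  by rewrite /Q sum3_swap12 sum3_swap23.
rewrite mulrS mulr2n {1}/Q {1}F1 F2 -!sum3D /F {F F1 F2}.
rewrite /sum3 big1 // => i _; rewrite big1 // => j _; rewrite big1 // => k _.
rewrite -!big_split big1 // => m _ /=.
rewrite -[E m (a i _)]/(E m (a i (a k (a j v)))) -[a k (a j (a i v))]aaa.
rewrite [a j (a i (a k v))]aaa -!mulrzDr /cE -!big_split /=.
rewrite -[RHS](mulr0z (E m (a i (a k (a j v))))); congr (_ *~ _).
rewrite -[RHS]oppr0 -[in RHS](c_jacobi i j k m) -sumrN; apply: eq_bigr => l _.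
by rewrite ![c l _ _]c_skew; ring.
Qed.

(** Pushing the outer [ce_d] through the three odd factors [E l], [a j], [a i] of the inner one
    returns minus the square itself, plus corrections that amount to 4 [Q]. Hence twice the square
    is 4 [Q], and a further factor 3 lets [ce_d_jacobi] apply. *)
Lemma ce_dd v : ce_d (ce_d v) *+ 6 = 0.
Proof.
have QE : Q v = \sum_p \sum_q sum3 (fun k m l =>
    E m (a k (a q (a p v))) *~ (c p q l * c l k m)).
  apply: eq_bigr => p _; apply: eq_bigr => q _; apply: eq_bigr => k _.
  by apply: eq_bigr => m _; rewrite raddf_sum.
pose T i j l := ce_ad l (a j (a i v)) *~ c i j l.
pose U i j l := E l (ce_coad j (a i v)) *~ c i j l.
pose W i j l := E l (a j (ce_coad i v)) *~ c i j l.
have ET : sum3 T = Q v.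
  rewrite QE; apply: eq_bigr => i _; apply: eq_bigr => j _.
  rewrite -[RHS]sum3_swap23 -[RHS]sum3_swap12; apply: eq_bigr => l _.
  rewrite /T /ce_ad mulrz_suml; apply: eq_bigr => k _.
  rewrite mulrz_suml; apply: eq_bigr => m _.
  by rewrite -mulrzA mulrC.
have EU : sum3 U = - Q v.
  rewrite QE; pose H p q i j l :=
    - (E l (a i (a q (a p v))) *~ (c p q j * c j i l)).
  transitivity (sum3 (fun i j l => \sum_p \sum_q H p q i j l)).
    apply: eq_sum3 => i j l; rewrite /U /ce_coad raddf_sum mulrz_suml.
    apply: eq_bigr => p _; rewrite raddf_sum mulrz_suml; apply: eq_bigr => q _.
    rewrite raddfMz /H -mulrNz -mulrzA /= [in RHS]aaa; congr (_ *~ _).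
    by rewrite [c j i l]c_skew; ring.
  rewrite -sum3_exch -sumrN; apply: eq_bigr => p _.
  rewrite -sum3_exch -sumrN; apply: eq_bigr => q _.
  by rewrite [LHS]sum3_swap23 -sum3N.
have EW : sum3 W = Q v.
  rewrite QE; pose H p q i j l := E l (a j (a q (a p v))) *~ (c p q i * c i j l).
  transitivity (sum3 (fun i j l => \sum_p \sum_q H p q i j l)).
    apply: eq_sum3 => i j l; rewrite /W /ce_coad !raddf_sum mulrz_suml.
    apply: eq_bigr => p _; rewrite !raddf_sum mulrz_suml; apply: eq_bigr => q _.
    by rewrite !raddfMz /H -mulrzA /=.
  rewrite -sum3_exch; apply: eq_bigr => p _.
  rewrite -sum3_exch; apply: eq_bigr => q _.
  by rewrite [LHS]sum3_swap12 [LHS]sum3_swap23 [LHS]sum3_swap12 sum3_swap12.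
have E2 : ce_d (ce_d v) = sum3 T *+ 2 - sum3 U + sum3 W - ce_d (ce_d v).
  set w := ce_d v.
  have {1}-> : w = sum3 (fun i j l => E l (a j (a i v)) *~ c i j l) by [].
  rewrite [X in _ - X]/ce_d raddf_sum3 /= -sum3Mn -sum3B -sum3D -sum3B.
  apply: eq_sum3 => i j l; rewrite raddfMz /= ce_dE !ce_da -/w.
  rewrite [a j (_ - _)]raddfB /= [E l (_ - (_ - _))]raddfB /=.
  rewrite [E l (_ - _)]raddfB /= /T /U /W opprB !mulrzDl !mulNrz.
  rewrite mulr2n -!addrA; congr (_ + (_ + _)).
  by rewrite addrA addrC.
have {E2} : ce_d (ce_d v) *+ 2 = Q v *+ 4.
  rewrite mulr2n {1}E2 subrK ET EU EW opprK -addrA -mulr2n -mulrnDr //.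
by rewrite (_ : 6 = 2 * 3)%N // mulrnA => ->; rewrite mulrnAC ce_d_jacobi mul0rn.
Qed.

Lemma ce_adE m n w : ce_ad m (E n w) =
  \sum_l E l w *~ c m n l - \sum_j \sum_l E l (E n (a j w)) *~ c m j l.
Proof.
transitivity (\sum_j \sum_l (E l w *~ c m j l *+ (j == n) -
    E l (E n (a j w)) *~ c m j l)).
  apply: eq_bigr => j _; apply: eq_bigr => l _.
  rewrite aE [E l (_ - _)]raddfB raddfMn /= mulrzBl.
  by case: (j == n); rewrite ?mulr0n ?mul0rz.
under eq_bigr do rewrite sumrB.
rewrite sumrB; congr (_ - _).
by rewrite exchange_big; apply: eq_bigr => l _; rewrite sum_delta.
Qed.

(** Normal-ordered coefficients of the Laplacian of the doubled operators. In [lap_coef4] the first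
    sum fuses x, y to p and splits p into z, w; in the second, x = m + w hands m over to y, which
    becomes z. *)
Definition lap_coef2 l p := \sum_m \sum_n c m n p * c m n l.
Definition lap_coef4 x y z w :=
  \sum_p c z w p * c x y p - (\sum_m c m w x * c m y z) *+ 4.

(** A monomial of [ce_delta] has three odd factors, so moving [ce_d] through it yields a term that
    cancels the second summand. Two doubled [ce_ad] terms and one [ce_coad] term remain; the crossed
    sum occurs in both [ce_ad] terms, which explains the 4 in [lap_coef4]. *)
Lemma ce_lapE v : ce_d (ce_delta v) + ce_delta (ce_d v) =
  (\sum_l \sum_p E l (a p v) *~ lap_coef2 l p) *+ 2 +
  \sum_z \sum_w \sum_y \sum_x E z (E w (a y (a x v))) *~ lap_coef4 x y z w.
Proof.
pose H2 m n p := (\sum_l E l (a p v) *~ c m n l) *~ c m n p.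
pose H4 m n p := (\sum_j \sum_l E l (E n (a j (a p v))) *~ c m j l) *~ c m n p.
pose J4 m n p := E m (E n (ce_coad p v)) *~ c m n p.
pose K4 m n p := E m (ce_ad n (a p v)) *~ c m n p.
have -> : ce_d (ce_delta v) + ce_delta (ce_d v) =
    (sum3 H2 - sum3 H4) *+ 2 - sum3 K4 *+ 2 + sum3 J4.
  rewrite {1}/ce_delta raddf_sum3 -sum3D -sum3B -!sum3Mn -sum3B -sum3D.
  apply: eq_sum3 => m n p; rewrite raddfMz /= !ce_dE ce_da ce_adE.
  rewrite [E n (_ - _)]raddfB [E m (_ - (_ - _))]raddfB /=.
  rewrite [E m (_ - _)]raddfB [E m (_ *+ _)]raddfMn /= /H2 /H4 /K4 /J4.
  rewrite -mulrzDl -mulrzBl !pmulrn ![_ *~ c m n p *~ _]mulrzAC.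
  rewrite -mulrzBl -mulrzDl; congr (_ *~ _).
  rewrite opprB -[LHS]addrA -[RHS]addrA; congr (_ + _).
  by rewrite addrAC subrK addrC.
have -> : sum3 K4 = sum3 H4.
  rewrite sum3_swap12; apply: eq_sum3 => m n p.
  rewrite /K4 /H4 /ce_ad raddf_sum !mulrz_suml; apply: eq_bigr => j _.
  rewrite raddf_sum !mulrz_suml; apply: eq_bigr => l _.
  by rewrite raddfMz /= EE [c n m p]c_skew !mulNrz mulrNz opprK.
have -> : sum3 H2 = \sum_l \sum_p E l (a p v) *~ lap_coef2 l p.
  transitivity (\sum_p \sum_l \sum_m \sum_n E l (a p v) *~ (c m n p * c m n l)).
    rewrite /sum3; under eq_bigr => m _.
      rewrite exchange_big.
      under eq_bigr => p _.
        under eq_bigr => n _ do rewrite /H2 mulrz_suml.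
        rewrite exchange_big.
        over.
      over.
    rewrite exchange_big; apply: eq_bigr => p _.
    rewrite exchange_big; apply: eq_bigr => l _.
    apply: eq_bigr => m _; apply: eq_bigr => n _.
    by rewrite -mulrzA mulrC.
  rewrite exchange_big; apply: eq_bigr => l _; apply: eq_bigr => p _.
  by rewrite raddf_sum; apply: eq_bigr => m _; rewrite raddf_sum.
have -> : sum3 H4 = \sum_z \sum_w \sum_y \sum_x
    E z (E w (a y (a x v))) *~ \sum_m c m w x * c m y z.
  rewrite /sum3 /H4.
  under eq_bigr => m _.
    under eq_bigr => w _.
      under eq_bigr => x _.
        rewrite mulrz_suml.
        under eq_bigr => y _ do rewrite mulrz_suml.
        over.
      rewrite exchange_big.
      under eq_bigr => y _ do rewrite exchange_big.
      rewrite exchange_big.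
      over.
    rewrite exchange_big.
    over.
  rewrite exchange_big; apply: eq_bigr => z _.
  rewrite exchange_big; apply: eq_bigr => w _.
  rewrite exchange_big; apply: eq_bigr => y _.
  rewrite exchange_big; apply: eq_bigr => x _.
  rewrite raddf_sum; apply: eq_bigr => m _.
  by rewrite -mulrzA mulrC.
have -> : sum3 J4 = \sum_z \sum_w \sum_y \sum_x
    E z (E w (a y (a x v))) *~ \sum_p c z w p * c x y p.
  apply: eq_bigr => z _; apply: eq_bigr => w _.
  rewrite exchange_big /= exchange_big /=.
  transitivity (\sum_p \sum_x \sum_y
    E z (E w (a y (a x v))) *~ (c z w p * c x y p)).
    apply: eq_bigr => p _; rewrite /J4 /ce_coad !raddf_sum mulrz_suml.
    apply: eq_bigr => x _; rewrite !raddf_sum mulrz_suml.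
    by apply: eq_bigr => y _; rewrite !raddfMz /= -mulrzA mulrC.
  rewrite exchange_big [RHS]exchange_big; apply: eq_bigr => x _.
  rewrite exchange_big; apply: eq_bigr => y _.
  by rewrite raddf_sum.
rewrite mulrnBl -!addrA; congr (_ + (_ + _)); rewrite addrA -opprD -mulrnDr.
rewrite -sumrMnl -sumrN -big_split; apply: eq_bigr => z _.
rewrite -sumrMnl -sumrN -big_split; apply: eq_bigr => w _.
rewrite -sumrMnl -sumrN -big_split; apply: eq_bigr => y _.
rewrite -sumrMnl -sumrN -big_split; apply: eq_bigr => x _.
by rewrite /= /lap_coef4 mulrzBr [_ *~ (_ *+ 4)]raddfMn /= addrC.
Qed.
End Fermions.

(** * Creation and annihilation operators on the exterior algebra *)

Section ExteriorOperators.
Variable N : nat.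
Implicit Types (s t : {set 'I_N}) (i j k : 'I_N) (u v : ext N).

Definition ext_sign k t : int := (-1) ^+ #|[set m in t | (m < k)%N]|.

Definition create k u : ext N :=
  [ffun t : {set 'I_N} => if k \in t then ext_sign k t * u (t :\ k) else 0].
Definition annihilate k u : ext N :=
  [ffun t : {set 'I_N} => if k \in t then 0 else ext_sign k t * u (k |: t)].

Lemma ext_signD1 i j t :
  i \in t -> ext_sign j (t :\ i) = (if (i < j)%N then -1 else 1) * ext_sign j t.
Proof.
move=> it; rewrite /ext_sign; case: ifP => ij.
  rewrite [in RHS](cardsD1 i) inE it ij exprS mulrA mulrNN mulr1 mul1r.
  by congr (_ ^+ _); apply: eq_card => m; rewrite !inE andbA.
rewrite mul1r; congr (_ ^+ _); apply: eq_card => m; rewrite !inE.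
by have [->|] := eqVneq m i; rewrite ?ij ?andbF.
Qed.

Lemma ext_signU1 i j t : i \notin t ->
  ext_sign j (i |: t) = (if (i < j)%N then -1 else 1) * ext_sign j t.
Proof.
move=> it; have := @ext_signD1 i j (i |: t) (setU11 _ _); rewrite setU1K // => ->.
by case: ifP; rewrite ?mul1r // mulrA mulrNN !mul1r.
Qed.

Lemma ext_sign2 k t : ext_sign k t * ext_sign k t = 1.
Proof. by rewrite /ext_sign -expr2 sqrr_sign. Qed.

Lemma create_is_additive k : zmod_morphism (create k).
Proof. by move=> u v; apply/ffunP=> t; rewrite !ffunE; case: ifP;
  rewrite ?mulrBr ?subr0. Qed.
Lemma annihilate_is_additive k : zmod_morphism (annihilate k).
Proof. by move=> u v; apply/ffunP=> t; rewrite !ffunE; case: ifP;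
  rewrite ?mulrBr ?subr0. Qed.
HB.instance Definition _ k :=
  GRing.isZmodMorphism.Build (ext N) (ext N) (create k) (create_is_additive k).
HB.instance Definition _ k :=
  GRing.isZmodMorphism.Build (ext N) (ext N) (annihilate k)
    (annihilate_is_additive k).

Lemma createC i j v : create i (create j v) = - create j (create i v).
Proof.
apply/ffunP => t; rewrite !ffunE !inE eq_sym.
have [->|ij] /= := eqVneq i j; first by case: ifP; rewrite ?mulr0 oppr0.
case: (boolP (i \in t)) => it; case: (boolP (j \in t)) => jt;
  rewrite ?mulr0 ?oppr0 //.
rewrite setDDl setUC -setDDl !ext_signD1 //.
by case: (ltngtP i j) (ij) => [||/val_inj->]; rewrite ?eqxx // => *; ring.
Qed.

Lemma annihilateC i j v :
  annihilate i (annihilate j v) = - annihilate j (annihilate i v).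
Proof.
apply/ffunP => t; rewrite !ffunE !inE eq_sym.
have [->|ij] /= := eqVneq i j; first by case: ifP; rewrite ?mulr0 oppr0.
case: (boolP (i \in t)) => it; case: (boolP (j \in t)) => jt;
  rewrite ?mulr0 ?oppr0 //=.
rewrite setUCA !ext_signU1 //.
by case: (ltngtP i j) (ij) => [||/val_inj->]; rewrite ?eqxx // => *; ring.
Qed.

Lemma annihilate_create i j v :
  annihilate i (create j v) = v *+ (i == j) - create j (annihilate i v).
Proof.
apply/ffunP => t; rewrite mulrb !ffunE !inE (fun_if (fun w : ext N => w t)) !ffunE.
have [->|ij] /= := eqVneq i j.
  case: (boolP (j \in t)) => jt.
    by rewrite setD1K // ext_signD1 // ltnn mul1r mulrA ext_sign2 mul1r subrr.
  by rewrite setU1K // ext_signU1 // ltnn mul1r mulrA ext_sign2 mul1r subr0.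
rewrite sub0r.
case: (boolP (i \in t)) => it; case: (boolP (j \in t)) => jt;
  rewrite ?mulr0 ?oppr0 //=.
rewrite ext_signU1 // ext_signD1 //.
have -> : (i |: t) :\ j = i |: t :\ j.
  apply/setP => m; rewrite !inE; have [->|] //= := eqVneq m i.
  by rewrite ij.
by case: (ltngtP i j) (ij) => [||/val_inj->]; rewrite ?eqxx // => *; ring.
Qed.

(** Sets containing k correspond to sets without k, and the sign, counting only elements below k, is
    the same for both. This is what makes [ce_delta] the transpose of [ce_d]. *)
Lemma create_adj k u v :
  \sum_t create k u t * v t = \sum_t u t * annihilate k v t.
Proof.
transitivity (\sum_(t : {set 'I_N} | k \in t) ext_sign k t * u (t :\ k) * v t).
  by rewrite [RHS]big_mkcond; apply: eq_bigr => t _; rewrite ffunE; case: ifP;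
     rewrite ?mul0r.
transitivity (\sum_(t : {set 'I_N} | k \notin t) ext_sign k t * u t * v (k |: t)).
  rewrite (reindex_onto (fun t => k |: t) (fun t => t :\ k)) /=; last first.
    by move=> t kt; rewrite setD1K.
  apply: eq_big => [t|t /andP[_ /eqP E]].
    rewrite setU11; apply/eqP/idP => [<-|/setU1K//].
    by rewrite setD11.
  by rewrite E ext_signU1 ?ltnn ?mul1r // -E setD11.
rewrite [LHS]big_mkcond; apply: eq_bigr => t _; rewrite ffunE.
by case: (k \in t) => /=; rewrite ?mulr0 // mulrA [_ * u t]mulrC.
Qed.

Lemma create_annihilate k u t :
  create k (annihilate k u) t = if k \in t then u t else 0.
Proof.
rewrite !ffunE; case: ifP => // kt.
by rewrite !inE eqxx /= setD1K // ext_signD1 // ltnn mul1r mulrA ext_sign2 mul1r.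
Qed.

Lemma create_diag_annihilate k (g : {set 'I_N} -> int) (f : ext N -> ext N) u t :
  (forall v s, f v s = g s * v s) ->
  create k (f (annihilate k u)) t = if k \in t then g (t :\ k) * u t else 0.
Proof.
move=> fg; rewrite !ffunE; case: ifP => // kt; rewrite fg mulrCA.
have := create_annihilate k u t; rewrite kt => <-.
by rewrite [in RHS]ffunE kt.
Qed.

Lemma ext_mulrzE u (n : int) t : (u *~ n) t = u t * n.
Proof.
rewrite -mulrzz; case: n => n; first exact: ffunMnE.
by rewrite !NegzE !mulrNz ffunE -!pmulrn ffunMnE.
Qed.

Lemma ext_scaleE (n : int) u : n *: u = u *~ n.
Proof. by apply/ffunP => t; rewrite ext_mulrzE ffunE /= mulrC. Qed.

Lemma ext_mulE x u : ext_mul x u = \sum_k create k u *~ x k.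
Proof.
apply/ffunP => t; rewrite ffunE sum_ffunE big_mkcond; apply: eq_bigr => k _.
rewrite ext_mulrzE ffunE; case: ifP => _; last by rewrite mul0r.
by rewrite /ext_sign mulrAC.
Qed.

Lemma ext_mul_gen_create k u : ext_mul (gen k) u = create k u.
Proof.
rewrite ext_mulE (bigD1 k) //= big1 ?addr0 => [|m mk].
  by rewrite ffunE eqxx.
by rewrite ffunE (negPf mk) mulr0z.
Qed.

Lemma ext_mul_create x k u : ext_mul x (create k u) = - create k (ext_mul x u).
Proof.
rewrite !ext_mulE raddf_sum -sumrN; apply: eq_bigr => m _.
by rewrite raddfMz /= createC mulNrz.
Qed.

Definition omit1 (l : seq 'I_N) (m : 'I_(size l)) : seq 'I_N :=
  [seq tnth (in_tuple l) n | n <- enum 'I_(size l) & n != m].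

Lemma omit1_0 k l : omit1 (l := k :: l) ord0 = l.
Proof.
rewrite /omit1 enum_ordSl /= filter_map.
rewrite (eq_filter (a2 := predT)) => [|m //]; rewrite filter_predT -map_comp.
rewrite -[RHS](map_tnth_enum (in_tuple l)); apply: eq_map => m /=.
by rewrite !(tnth_nth k).
Qed.

Lemma omit1_lift k l (m : 'I_(size l)) :
  omit1 (l := k :: l) (lift ord0 m) = k :: omit1 m.
Proof.
rewrite /omit1 enum_ordSl /= filter_map; congr (_ :: _).
rewrite -map_comp; rewrite (eq_filter (a2 := fun n => n != m)) => [|n /=].
  by apply: eq_map => n /=; rewrite !(tnth_nth k).
by rewrite (inj_eq (@lift_inj _ _)).
Qed.

(** Contraction is an antiderivation: each occurrence of j is removed with the sign of its position.
    The list is arbitrary, repetitions included. *)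
Lemma annihilate_prod j (l : seq 'I_N) : annihilate j (ext_prod l) =
  \sum_(m < size l)
    ((-1) ^+ m *: ext_prod (omit1 m)) *+ (tnth (in_tuple l) m == j).
Proof.
elim: l => [|k l IH] /=.
  rewrite big_ord0; apply/ffunP => t; rewrite !ffunE; case: ifP => // _.
  by case: eqP => [/setP/(_ j)|]; rewrite ?mulr0 // !inE eqxx.
rewrite ext_mul_gen_create annihilate_create big_ord_recl omit1_0 expr0 scale1r.
rewrite eq_sym; congr (_ + _).
rewrite IH raddf_sum -sumrN; apply: eq_bigr => m _.
rewrite omit1_lift /= ext_mul_gen_create raddfMn /= -mulNrn.
rewrite (tnth_nth k) (tnth_nth k) /=; congr (_ *+ _).
rewrite /bump /= exprS mulN1r scaleNr; congr (- _).
by rewrite !ext_scaleE raddfMz.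
Qed.

Section Bracket.
Variable br : freeZ N -> freeZ N -> freeZ N.
Let c i j k : int := br (gen i) (gen j) k.
Hypothesis c_skew : forall i j k, c j i k = - c i j k.

Local Notation dd := (ce_d create annihilate c).

(** Pairs through the head k give the first sum, with sign exponent (m + 1) - 0 - 1 = m. For pairs
    inside the tail j - i - 1 is unchanged, but k now stands behind the bracket, and moving it to
    the front costs the minus sign. *)
Lemma d_prod_cons k l : d_prod br (in_tuple (k :: l)) =
  \sum_(m < size l)
     (-1) ^+ m *: ext_mul (br (gen k) (gen (tnth (in_tuple l) m)))
                          (ext_prod (omit1 m))
  - create k (d_prod br (in_tuple l)).
Proof.
rewrite /d_prod big_ord_recl big1 ?add0r // raddf_sum -sumrB.
apply: eq_bigr => j _.
rewrite big_mkcond big_ord_recl /=; congr (_ + _).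
  rewrite /bump /= subn0 subn1 add1n /= !(tnth_nth k) /=; congr (_ *: ext_mul _ _).
  rewrite enum_ordSl /= filter_map -map_comp; congr ext_prod.
  rewrite (eq_filter (a2 := fun n => n != j)) => [|n /=].
    by apply: eq_map => n /=; rewrite !(tnth_nth k).
  by rewrite (inj_eq (@lift_inj _ _)).
rewrite raddf_sum -sumrN [RHS]big_mkcond; apply: eq_bigr => i _.
rewrite /bump !add1n ltnS; case: ifP => // _.
rewrite subSS !(tnth_nth k) /= !ext_scaleE raddfMz -mulNrz /= -ext_mul_create.
congr (ext_mul _ _ *~ _); rewrite enum_ordSl /= -ext_mul_gen_create.
congr ext_mul; rewrite filter_map -map_comp; congr ext_prod.
rewrite (eq_filter (a2 := fun n => (n != i) && (n != j))) => [|n /=].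
  by apply: eq_map => n /=; rewrite !(tnth_nth k).
by rewrite !(inj_eq (@lift_inj _ _)).
Qed.

(** Both sides obey the same recursion on the first factor: [ce_dE] is twice [d_prod_cons], once
    [ce_ad] of a product is expanded by [annihilate_prod]. *)
Lemma ce_d_prod (l : seq 'I_N) :
  dd (ext_prod l) = d_prod br (in_tuple l) *+ 2.
Proof.
elim: l => [|k l IH].
  rewrite /d_prod big_ord0 mul0rn /ce_d /sum3 big1 // => i _;
    rewrite big1 // => j _.
  rewrite big1 // => l _; rewrite /= (annihilate_prod i [::]) big_ord0.
  by rewrite !raddf0 mul0rz.
rewrite /= ext_mul_gen_create ce_dE; first last.
- exact: c_skew.
- exact: annihilate_create.
- exact: createC.
rewrite IH raddfMn -mulrnBl d_prod_cons; congr ((_ - _) *+ _).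
rewrite /ce_ad.
transitivity (\sum_j ext_mul (br (gen k) (gen j)) (annihilate j (ext_prod l))).
  by apply: eq_bigr => j _; rewrite ext_mulE.
transitivity (\sum_j \sum_(m < size l) ((-1) ^+ m *: ext_mul (br (gen k) (gen j))
    (ext_prod (omit1 m))) *+ (j == tnth (in_tuple l) m)).
  apply: eq_bigr => j _; rewrite annihilate_prod ext_mulE.
  under eq_bigr do rewrite raddf_sum mulrz_suml.
  rewrite exchange_big; apply: eq_bigr => m _.
  rewrite ext_mulE scaler_sumr -sumrMnl; apply: eq_bigr => i _.
  rewrite eq_sym raddfMn /= !ext_scaleE raddfMz.
  by case: eqP; rewrite ?mulr0n ?mul0rz // mulr1n mulrzAC.
by rewrite exchange_big; apply: eq_bigr => m _; rewrite sum_delta.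
Qed.

End Bracket.
End ExteriorOperators.

(** * Root systems and structure constants *)

Section Roots.
Variables (R : realType) (V : vectType R) (S : rootSystem V).
Local Notation "<< u , v >>" := (dot S u v).
Implicit Types u v w a b : V.

Lemma dotDr u v w : <<u, v + w>> = <<u, v>> + <<u, w>>.
Proof. by rewrite dotC dotD !(dotC _ u). Qed.
Lemma dotZr k u v : <<u, k *: v>> = k * <<u, v>>.
Proof. by rewrite dotC dotZ (dotC _ u). Qed.
Lemma dotN u v : <<- u, v>> = - <<u, v>>.
Proof. by rewrite -scaleN1r dotZ mulN1r. Qed.
Lemma dotNr u v : <<u, - v>> = - <<u, v>>.
Proof. by rewrite dotC dotN dotC. Qed.
Lemma dotBr u v w : <<u, v - w>> = <<u, v>> - <<u, w>>.
Proof. by rewrite dotDr dotNr. Qed.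
Lemma dotBl u v w : <<u - v, w>> = <<u, w>> - <<v, w>>.
Proof. by rewrite dotD dotN. Qed.
Lemma dot0 v : <<0, v>> = 0.
Proof. by rewrite -(scale0r 0) dotZ mul0r. Qed.
Lemma dot_suml (I : Type) (r : seq I) (Q : pred I) (F : I -> V) v :
  <<\sum_(i <- r | Q i) F i, v>> = \sum_(i <- r | Q i) <<F i, v>>.
Proof.
exact: (big_morph (fun u => <<u, v>>) (fun u w => dotD _ u w v) (dot0 v)).
Qed.
Lemma dot_sumr (I : Type) (r : seq I) (Q : pred I) (F : I -> V) v :
  <<v, \sum_(i <- r | Q i) F i>> = \sum_(i <- r | Q i) <<v, F i>>.
Proof. by rewrite dotC dot_suml; apply: eq_bigr => i _; rewrite dotC. Qed.

Lemma root_neq0 a : a \in roots S -> a != 0.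
Proof. by apply: contraTneq => ->; exact: roots_neq0. Qed.

Lemma root_dot_gt0 a : a \in roots S -> 0 < <<a, a>>.
Proof. by move/root_neq0/dot_gt0. Qed.

Lemma root_opp a : a \in roots S -> - a \in roots S.
Proof.
move=> ra; have := roots_refl ra ra.
rewrite mulfK ?gt_eqF ?root_dot_gt0 // scaler_nat mulr2n opprD addrA subrr.
by rewrite sub0r.
Qed.

(** Both Cartan integers are positive. If one is 1, a reflection yields the difference up to sign.
    If both are at least 2, then (a,b) dominates (a,a) and (b,b), which forces a - t b = 0 for t =
    (a,b)/(b,b); reducedness then leaves only t = 1 or t = -1. *)
Lemma root_sub a b :
  a \in roots S -> b \in roots S -> a != b -> 0 < <<a, b>> -> a - b \in roots S.
Proof.
move=> ra rb ab ab0; have a0 := root_dot_gt0 ra; have b0 := root_dot_gt0 rb.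
have [m mE] := intrP (roots_int ra rb); have [n nE] := intrP (roots_int rb ra).
have m0 : (0 < m)%R.
  by rewrite -(ltr0z R) -mE divr_gt0 // mulr_gt0 // dotC.
have n0 : (0 < n)%R by rewrite -(ltr0z R) -nE divr_gt0 // mulr_gt0.
have [m1|m1] := eqVneq m 1.
  have := root_opp (roots_refl ra rb).
  by rewrite mE m1 scale1r opprB.
have [n1|n1] := eqVneq n 1.
  by have := roots_refl rb ra; rewrite nE n1 scale1r.
exfalso; have m2 : (2 <= m%:~R :> R) by rewrite (ler_int _ 2 m); lia.
have n2 : (2 <= n%:~R :> R) by rewrite (ler_int _ 2 n); lia.
move: m2 n2; rewrite -mE -nE dotC !ler_pdivlMr // => m2 n2.
pose t := <<a, b>> / <<b, b>>; have t0 : 0 < t by rewrite divr_gt0.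
have tb : t * <<b, b>> = <<a, b>> by rewrite divfK ?gt_eqF.
have x0 : a - t *: b = 0.
  apply/eqP; apply: contraT => /(dot_gt0 S).
  rewrite dotBl !dotBr !dotZ !dotZr (dotC _ b a) tb.
  have tE : t * <<a, b>> * <<b, b>> = <<a, b>> * <<a, b>> by rewrite mulrAC tb.
  by nra.
have atb : a = t *: b by apply/eqP; rewrite -subr_eq0 x0.
case: (roots_reduced (a := b) (c := t) rb); first by rewrite -atb.
  by move=> t1; move: ab; rewrite atb t1 scale1r eqxx.
by move=> t1; move: t0; rewrite t1; lra.
Qed.

Lemma root_add a b :
  a \in roots S -> b \in roots S -> a + b != 0 -> <<a, b>> < 0 -> a + b \in roots S.
Proof.
move=> ra rb ab ab0; rewrite -[b]opprK; apply: root_sub => //.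
- exact: root_opp.
- by rewrite -subr_eq0 opprK.
- by rewrite dotNr oppr_gt0.
Qed.

End Roots.

Section PositiveRoots.
Variables (R : realType) (V : vectType R) (S : rootSystem V).
Variable P : positiveSystem S.
Local Notation N := (npos P).
Local Notation e_ := (@proot _ _ _ P).
Local Notation "<< u , v >>" := (dot S u v).
Implicit Types i j k x y z w : 'I_N.

Definition pos_fun : 'Hom(V, R^o) := projT1 (cid (proot_pos P)).
Local Notation f := pos_fun.

Lemma pos_fun_neq0 a : a \in roots S -> f a != 0.
Proof. by rewrite /pos_fun; case: cid => g [h1 h2] /=; apply: h1. Qed.

Lemma prootP a : (exists i, a = e_ i) <-> (a \in roots S /\ 0 < f a).
Proof. by rewrite /pos_fun; case: cid => g [h1 h2] /=; apply: h2. Qed.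

Lemma proot_root i : e_ i \in roots S.
Proof. by have [] := (prootP (e_ i)).1 (ex_intro _ i erefl). Qed.

Lemma proot_gt0 i : 0 < f (e_ i).
Proof. by have [] := (prootP (e_ i)).1 (ex_intro _ i erefl). Qed.

Lemma pos_root a : a \in roots S -> 0 < f a -> exists i, a = e_ i.
Proof. by move=> ra fa; apply/prootP. Qed.

Lemma root_pos_neg a : a \in roots S -> exists i, a = e_ i \/ a = - e_ i.
Proof.
move=> ra; have := pos_fun_neq0 ra; rewrite neq_lt => /orP[fa|/(pos_root ra)[i]].
  have [|i ai] := pos_root (root_opp ra); first by rewrite linearN oppr_gt0.
  by exists i; right; rewrite -ai opprK.
by exists i; left.
Qed.

Lemma proot_sub i j : i != j -> 0 < <<e_ i, e_ j>> ->
  exists k, e_ i = e_ j + e_ k \/ e_ j = e_ i + e_ k.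
Proof.
move=> ij dij.
have [|k [E|E]] := root_pos_neg (root_sub (proot_root i) (proot_root j) _ dij).
- by rewrite (inj_eq (@proot_inj _ _ _ P)).
- by exists k; left; rewrite -E addrC subrK.
- by exists k; right; rewrite -[e_ k]opprK -E opprB addrC subrK.
Qed.

Lemma proot_add i j : <<e_ i, e_ j>> < 0 -> exists k, e_ k = e_ i + e_ j.
Proof.
move=> dij; have fij : 0 < f (e_ i + e_ j) by rewrite linearD addr_gt0 ?proot_gt0.
have [|k ->] := pos_root (root_add (proot_root i) (proot_root j) _ dij) fij.
  by apply: contraTneq fij => ->; rewrite linear0 ltxx.
by exists k.
Qed.

Lemma proot_dot_gt0 i : 0 < <<e_ i, e_ i>>.
Proof. exact: root_dot_gt0 (proot_root i). Qed.

(** Here x + y = z + w and x - w = z - y. If x - w were not a root up to sign, then (x,y), (z,w) >=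
    0 >= (x,w), (y,z), while (x,y) + (z,w) - (x,w) - (y,z) = -(i,i) < 0. *)
Lemma proot_cross x y z w i :
  e_ z = e_ x + e_ i -> e_ y = e_ w + e_ i -> x != w ->
  (forall k, e_ k != e_ x + e_ y) ->
  exists j, (e_ x = e_ w + e_ j /\ e_ z = e_ y + e_ j) \/
            (e_ w = e_ x + e_ j /\ e_ y = e_ z + e_ j).
Proof.
move=> zE yE xw nk.
have xy0 : 0 <= <<e_ x, e_ y>>.
  by rewrite leNgt; apply/negP => /proot_add[k kE]; have := nk k; rewrite kE eqxx.
have zw0 : 0 <= <<e_ z, e_ w>>.
  rewrite leNgt; apply/negP => /proot_add[k kE]; have := nk k.
  by rewrite kE zE yE addrA addrAC eqxx.
have yz : y != z.
  apply: contra xw => /eqP yz; apply/eqP; apply: (@proot_inj _ _ _ P).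
  by apply: (addIr (e_ i)); rewrite -zE -yE yz.
have [xw0|xw0] := ltP 0 <<e_ x, e_ w>>.
  have [j [E|E]] := proot_sub xw xw0; exists j; [left|right]; split => //.
    by rewrite zE yE E addrAC.
  by rewrite zE yE E addrAC.
have [yz0|yz0] := ltP 0 <<e_ y, e_ z>>.
  have [j [E|E]] := proot_sub yz yz0; exists j; [right|left]; split => //.
    by apply: (addIr (e_ i)); rewrite -yE E zE addrAC.
  by apply: (addIr (e_ i)); rewrite -zE E yE addrAC.
exfalso; move: xy0 zw0 yz0 xw0 (proot_dot_gt0 i).
rewrite zE yE !dotD !dotDr (dotC _ (e_ w) (e_ x)) (dotC _ (e_ i) (e_ w)).
by rewrite (dotC _ (e_ i) (e_ x)); lra.
Qed.

Variable L : rootLie P.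

Definition lie_coef i j k : int := lbr L (gen i) (gen j) k.
Local Notation c := lie_coef.

Lemma lie_coef_skew i j k : c j i k = - c i j k.
Proof.
have := lbrxx L (gen i + gen j); rewrite lbrDl !lbrDr !lbrxx add0r addr0.
by rewrite addrC => /eqP; rewrite addr_eq0 => /eqP E; rewrite /lie_coef E ffunE.
Qed.

Lemma lie_coef_neq0 i j k : c i j k != 0 -> e_ k = e_ i + e_ j.
Proof.
rewrite /lie_coef => ck; have [[m /eqP mE]|nm] :=
  pselect (exists m, e_ m == e_ i + e_ j).
  suff -> : k = m by [].
  apply/eqP; apply: contraNT ck => /negPf km.
  by case: (lbr_root L mE) => ->; rewrite !ffunE km ?oppr0.
move: ck; rewrite lbr_nonroot ?ffunE ?eqxx // => m; apply/negP => mE.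
by apply: nm; exists m.
Qed.

Lemma lie_coef0 i j k : e_ k != e_ i + e_ j -> c i j k = 0.
Proof. by move=> H; apply/eqP; apply: contraNT H => /lie_coef_neq0->. Qed.

Lemma lie_coefP i j k : e_ k = e_ i + e_ j -> c i j k = 1 \/ c i j k = -1.
Proof.
by move=> kE; rewrite /lie_coef; case: (lbr_root L kE) => ->; [left|right];
  rewrite !ffunE eqxx.
Qed.

Lemma lbr0r u : lbr L u 0 = 0.
Proof. by apply: (addIr (lbr L u 0)); rewrite -lbrDr !add0r. Qed.

Lemma lbr_sumr u (F : 'I_N -> freeZ N) :
  lbr L u (\sum_l F l) = \sum_l lbr L u (F l).
Proof. by apply: (big_morph (lbr L u)); [exact: lbrDr|exact: lbr0r]. Qed.

Lemma lbrMzr u v (n : int) : lbr L u (v *~ n) = lbr L u v *~ n.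
Proof.
have lbrMn m : lbr L u (v *+ m) = lbr L u v *+ m.
  by elim: m => [|m IH]; rewrite ?mulr0n ?lbr0r // !mulrS lbrDr IH.
have lbrNr t : lbr L u (- t) = - lbr L u t.
  by apply: (addIr (lbr L u t)); rewrite -lbrDr !addNr lbr0r.
by case: n => n; rewrite ?NegzE ?mulrNz ?lbrNr -!pmulrn lbrMn.
Qed.

Lemma freeZ_mulrzE (u : freeZ N) (n : int) k : (u *~ n) k = u k * n.
Proof.
rewrite -mulrzz; case: n => n; first exact: ffunMnE.
by rewrite !NegzE !mulrNz ffunE -!pmulrn ffunMnE.
Qed.

Lemma freeZ_expand (u : freeZ N) : u = \sum_l gen l *~ u l.
Proof.
apply/ffunP => k; rewrite sum_ffunE (bigD1 k) //= big1 ?addr0 => [|l lk].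
  by rewrite freeZ_mulrzE ffunE eqxx mul1r.
by rewrite freeZ_mulrzE ffunE eq_sym (negPf lk) mul0r.
Qed.

Lemma lbr_lbrE x y z w :
  lbr L (gen x) (lbr L (gen y) (gen z)) w = \sum_l c y z l * c x l w.
Proof.
rewrite [lbr L (gen y) _]freeZ_expand lbr_sumr sum_ffunE; apply: eq_bigr => l _.
by rewrite lbrMzr freeZ_mulrzE mulrC.
Qed.

Lemma lie_coef_jacobi x y z w :
  \sum_l (c y z l * c x l w + c z x l * c y l w + c x y l * c z l w) = 0.
Proof.
rewrite !big_split /= -!lbr_lbrE.
have := lbr_jacobi L (gen x) (gen y) (gen z).
by move/(congr1 (fun g : freeZ N => g w)); rewrite !ffunE.
Qed.

Lemma sum_single (F : 'I_N -> int) m :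
  (forall l, F l != 0 -> e_ l = e_ m) -> \sum_l F l = F m.
Proof.
move=> H; rewrite (bigD1 m) //= big1 ?addr0 // => l; apply: contraNeq.
by move=> /H /(@proot_inj _ _ _ P) ->.
Qed.

(* The third Jacobi term is 0 or +-1, and the sum of three signs is not 0. *)
Lemma jacobi_two_terms x y z p q w :
  e_ p = e_ y + e_ z -> e_ q = e_ z + e_ x -> e_ w = e_ x + e_ p ->
  c y z p * c x p w + c z x q * c y q w = 0.
Proof.
move=> pE qE wE; have := lie_coef_jacobi x y z w; rewrite !big_split /=.
have wE' : e_ w = e_ y + e_ q by rewrite wE pE qE addrCA [e_ x + _]addrC.
rewrite (sum_single (m := p)) => [|l]; last first.
  by rewrite mulf_eq0 negb_or pE => /andP[/lie_coef_neq0].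
rewrite (sum_single (m := q)) => [|l]; last first.
  by rewrite mulf_eq0 negb_or qE => /andP[/lie_coef_neq0].
have [[m mE]|nm] := pselect (exists m, e_ m = e_ x + e_ y); last first.
  rewrite [X in _ + X = 0]big1 ?addr0 // => l _; rewrite lie_coef0 ?mul0r //.
  by apply/negP => /eqP lE; apply: nm; exists l.
rewrite [X in _ + X = 0](sum_single (m := m)) => [|l]; last first.
  by rewrite mulf_eq0 negb_or mE => /andP[/lie_coef_neq0].
have wE'' : e_ w = e_ z + e_ m by rewrite mE wE pE addrC -addrA addrCA [e_ y +
  _]addrC.
case: (lie_coefP pE) => ->; case: (lie_coefP qE) => ->;
case: (lie_coefP wE) => ->; case: (lie_coefP wE') => ->;
case: (lie_coefP mE) => ->; case: (lie_coefP wE'') => ->; by [].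
Qed.

End PositiveRoots.

(** * The Laplacian is diagonal *)

Section Laplacian.
Variables (R : realType) (V : vectType R) (S : rootSystem V).
Variable P : positiveSystem S.
Variable L : rootLie P.
Local Notation N := (npos P).
Local Notation e_ := (@proot _ _ _ P).
Local Notation "<< u , v >>" := (dot S u v).
Local Notation c := (lie_coef L).
Local Notation f := (pos_fun P).
Implicit Types i j k x y z w : 'I_N.
Implicit Types s t : {set 'I_N}.

Definition direct_coef x y z w := \sum_l c x y l * c z w l.
Definition cross_coef x y z w := \sum_m c m w x * c m y z.
Local Notation T := direct_coef.
Local Notation C := cross_coef.

(* One fourth of the antisymmetrization of [lap_coef4 c] in x, y and in z, w. *)
Definition curv x y z w := T x y z w - (C x y z w - C y x z w - C x y w z + C y
  x w z).

Lemma curv_swapl x y z w : curv y x z w = - curv x y z w.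
Proof.
rewrite /curv; have -> : T y x z w = - T x y z w.
  by rewrite -sumrN; apply: eq_bigr => l _; rewrite lie_coef_skew mulNr.
by ring.
Qed.

Lemma curv_swapr x y z w : curv x y w z = - curv x y z w.
Proof.
rewrite /curv; have -> : T x y w z = - T x y z w.
  by rewrite -sumrN; apply: eq_bigr => l _; rewrite [c w z l]lie_coef_skew mulrN.
by ring.
Qed.

(** Exchanging removed and added indices reflects the self-adjointness of the Laplacian. *)
Lemma curv_rev x y z w : curv w z y x = curv x y z w.
Proof.
have CE a b a' b' : C a b a' b' = C a' b' a b.
  by apply: eq_bigr => m _; rewrite mulrC.
have -> : curv w z y x = T w z y x - (C y x w z - C y x z w - C x y w z + C x y
  z w).
  by rewrite /curv (CE w z y x) (CE z w y x) (CE w z x y) (CE z w x y); ring.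
have -> : T w z y x = T x y z w.
  by apply: eq_bigr => l _; rewrite lie_coef_skew [c y x l]lie_coef_skew mulrNN
    mulrC.
by rewrite /curv; ring.
Qed.

Lemma direct_coefE x y z w k : e_ k = e_ x + e_ y -> T x y z w = c x y k * c z w k.
Proof.
move=> kE; apply: sum_single => l; rewrite mulf_eq0 negb_or.
by move=> /andP[/lie_coef_neq0 ->].
Qed.

Lemma direct_coef0 x y z w : (forall k, e_ k != e_ x + e_ y) -> T x y z w = 0.
Proof. by move=> nk; apply: big1 => l _; rewrite lie_coef0 ?mul0r. Qed.

Lemma cross_coefE x y z w j : e_ z = e_ y + e_ j -> C x y z w = c j w x * c j y z.
Proof.
move=> zE; apply: sum_single => l; rewrite mulf_eq0 negb_or => /andP[_].
by move=> /lie_coef_neq0; rewrite zE addrC => /addIr.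
Qed.

Lemma cross_coef_neq0 x y z w : C x y z w != 0 ->
  exists j, e_ z = e_ y + e_ j /\ e_ x = e_ w + e_ j.
Proof.
move=> nz; have [[j [h1 h2]]|nj] :=
  pselect (exists j, e_ z = e_ y + e_ j /\ e_ x = e_ w + e_ j); first by exists j.
case/eqP: nz; apply: big1 => j _; apply/eqP; apply/negP => /negP.
rewrite mulf_eq0 negb_or => /andP[/lie_coef_neq0 E1 /lie_coef_neq0 E2].
by apply: nj; exists j; rewrite E1 E2 ![_ + e_ j]addrC.
Qed.

Lemma addr_proot_neq x i j : e_ x = e_ x + e_ i + e_ j -> False.
Proof.
move/(congr1 f); rewrite !linearD /= => E.
by have := proot_gt0 i; have := proot_gt0 j; rewrite -!/(pos_fun P); lra.
Qed.

(* Here z = w + i + j and k = 2w + i + j, and the Jacobi identities of (j, i, w),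
   (w, x, i) and (w, y, j) ask for contradictory signs. *)
Lemma no_triangle x y z w i j k :
  e_ z = e_ x + e_ i -> e_ y = e_ w + e_ i ->
  e_ z = e_ y + e_ j -> e_ x = e_ w + e_ j -> e_ k = e_ x + e_ y -> False.
Proof.
move=> zi yi zj xj kE.
have kwz : e_ k = e_ w + e_ z by rewrite kE xj zj -addrA [e_ j + _]addrC.
have jac := @jacobi_two_terms _ _ _ _ L.
have h1 : c i w y * c j y z + c w j x * c i x z = 0.
  by apply: jac => //; rewrite 1?addrC.
have h2 : c x i z * c w z k + c i w y * c x y k = 0.
  by apply: jac => //; rewrite 1?addrC.
have h3 : c y j z * c w z k + c j w x * c y x k = 0.
  by apply: jac => //; rewrite 1?addrC.
move: h1 h2 h3.
rewrite (lie_coef_skew L i x) (lie_coef_skew L j y) (lie_coef_skew L j w).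
rewrite (lie_coef_skew L x y).
have yi' : e_ y = e_ i + e_ w by rewrite addrC.
have zj' : e_ z = e_ j + e_ y by rewrite addrC.
have xj' : e_ x = e_ j + e_ w by rewrite addrC.
have zi' : e_ z = e_ i + e_ x by rewrite addrC.
case: (lie_coefP L yi') => ->; case: (lie_coefP L zj') => ->;
case: (lie_coefP L xj') => ->; case: (lie_coefP L zi') => ->;
case: (lie_coefP L kE) => ->; case: (lie_coefP L kwz) => ->; lia.
Qed.

(** Only [T x y z w] and [C y x z w] survive, and they cancel by the Jacobi identity of (w, x, i).
    Two of the other terms fall to [no_triangle], the last one to positivity. *)
Lemma curv_cross_direct x y z w i k :
  e_ z = e_ x + e_ i -> e_ y = e_ w + e_ i -> e_ k = e_ x + e_ y ->
  curv x y z w = 0.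
Proof.
move=> zi yi kE.
have kwz : e_ k = e_ w + e_ z by rewrite kE zi yi addrCA.
rewrite /curv (direct_coefE _ _ kE).
have -> : C x y z w = 0.
  apply/eqP/negP => /negP/cross_coef_neq0[j [zj xj]].
  exact: no_triangle zi yi zj xj kE.
have -> : C y x w z = 0.
  apply/eqP/negP => /negP/cross_coef_neq0[j [wj yj]].
  apply: (no_triangle yi zi yj wj).
  exact: kwz.
have -> : C x y w z = 0.
  apply/eqP/negP => /negP/cross_coef_neq0[m [wm xm]].
  by apply: (@addr_proot_neq x i m); rewrite -zi.
rewrite (cross_coefE _ _ zi).
have yi' : e_ y = e_ i + e_ w by rewrite addrC.
have zi' : e_ z = e_ i + e_ x by rewrite addrC.
have := @jacobi_two_terms _ _ _ _ L w x i z y k zi yi' kwz.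
rewrite (lie_coef_skew L i x) (lie_coef_skew L w z).
case: (lie_coefP L yi') => ->; case: (lie_coefP L zi') => ->;
case: (lie_coefP L kE) => ->; case: (lie_coefP L kwz) => ->; lia.
Qed.

(** With no direct term, [C x y z w] and [C y x z w] cancel by the Jacobi identity of (j, i, w). *)
Lemma curv_cross_cross x y z w i j :
  e_ z = e_ x + e_ i -> e_ y = e_ w + e_ i ->
  e_ z = e_ y + e_ j -> e_ x = e_ w + e_ j ->
  (forall k, e_ k != e_ x + e_ y) -> curv x y z w = 0.
Proof.
move=> zi yi zj xj nk; rewrite /curv direct_coef0 //.
have -> : C x y w z = 0.
  apply/eqP/negP => /negP/cross_coef_neq0[m [wm xm]].
  by apply: (@addr_proot_neq x i m); rewrite -zi.
have -> : C y x w z = 0.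
  apply/eqP/negP => /negP/cross_coef_neq0[m [wm ym]].
  by apply: (@addr_proot_neq y j m); rewrite -zj.
rewrite (cross_coefE _ _ zi) (cross_coefE _ _ zj).
have : c i w y * c j y z + c w j x * c i x z = 0.
  by apply: jacobi_two_terms => //; rewrite 1?addrC.
rewrite (lie_coef_skew L j w).
have yi' : e_ y = e_ i + e_ w by rewrite addrC.
have zj' : e_ z = e_ j + e_ y by rewrite addrC.
have xj' : e_ x = e_ j + e_ w by rewrite addrC.
have zi' : e_ z = e_ i + e_ x by rewrite addrC.
case: (lie_coefP L yi') => ->; case: (lie_coefP L zj') => ->;
case: (lie_coefP L xj') => ->; case: (lie_coefP L zi') => ->; lia.
Qed.

Lemma curv_cross x y z w i :
  e_ z = e_ x + e_ i -> e_ y = e_ w + e_ i -> x != w -> curv x y z w = 0.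
Proof.
move=> zi yi xw; have [[k kE]|nk] := pselect (exists k, e_ k = e_ x + e_ y).
  exact: curv_cross_direct zi yi kE.
have {}nk k : e_ k != e_ x + e_ y by apply/negP => /eqP kE; apply: nk; exists k.
have [j [[xj zj]|[wj yj]]] := proot_cross zi yi xw nk.
  exact: curv_cross_cross zi yi zj xj nk.
rewrite -curv_rev; apply: (curv_cross_cross yi zi yj wj) => k.
by rewrite -(_ : e_ x + e_ y = e_ w + e_ z) // zi yi addrCA.
Qed.

(** If a difference between {x, y} and {z, w} is a root, the symmetries of [curv] bring it into the
    position z - x treated by [curv_cross]. Otherwise all crossed terms vanish, and the direct one
    has to vanish too. *)
Lemma curv_eq0 x y z w : e_ x + e_ y = e_ z + e_ w ->
  x != z -> x != w -> y != z -> y != w -> curv x y z w = 0.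
Proof.
move=> E xz xw yz yw.
have E' : e_ y + e_ x = e_ z + e_ w by rewrite addrC.
have diff a b a' b' i : e_ a + e_ b = e_ a' + e_ b' -> e_ a' = e_ a + e_ i ->
    e_ b = e_ b' + e_ i.
  by move=> H1 H2; move: H1; rewrite H2 -addrA => /addrI; rewrite addrC.
have cxz i : e_ z = e_ x + e_ i -> curv x y z w = 0.
  by move=> H; apply: curv_cross H (diff _ _ _ _ _ E H) xw.
have czx i : e_ x = e_ z + e_ i -> curv x y z w = 0.
  move=> H; rewrite -[LHS]opprK -curv_swapl -curv_swapr.
  by apply: curv_cross (diff _ _ _ _ _ (esym E) H) H yz.
have cyz i : e_ z = e_ y + e_ i -> curv x y z w = 0.
  move=> H; rewrite -[LHS]opprK -curv_swapl (curv_cross H _ yw) ?oppr0 //.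
  exact: diff E' H.
have czy i : e_ y = e_ z + e_ i -> curv x y z w = 0.
  move=> H; rewrite -[LHS]opprK -curv_swapr (curv_cross _ H xz) ?oppr0 //.
  exact: diff (esym E') H.
have [xz0|xz0] := ltP 0 <<e_ x, e_ z>>.
  by have [m [/czx|/cxz]] := proot_sub xz xz0.
have [yz0|yz0] := ltP 0 <<e_ y, e_ z>>.
  by have [m [/czy|/cyz]] := proot_sub yz yz0.
have nC a b a' b' : (forall j, e_ a' = e_ b + e_ j -> e_ a = e_ b' + e_ j ->
  False) ->
    C a b a' b' = 0.
  by move=> H; apply/eqP/negP => /negP/cross_coef_neq0[j [h1 h2]]; apply: H h1 h2.
have [[j jE]|nj] := pselect (exists j, e_ z = e_ x + e_ j); first exact: cxz jE.
have [[j' jE]|nj'] := pselect (exists j, e_ z = e_ y + e_ j); first exact: cyz jE.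
have [[j'' jE]|nj''] := pselect (exists j, e_ x = e_ z + e_ j); first exact: czx jE.
have [[j3 jE]|nj3] := pselect (exists j, e_ y = e_ z + e_ j); first exact: czy jE.
rewrite /curv (nC x y z w) ?(nC y x z w) ?(nC x y w z) ?(nC y x w z); try by
  [move=> j h1 h2; apply: nj; exists j|move=> j h1 h2; apply: nj'; exists j
  |move=> j h1 h2; apply: nj''; exists j|move=> j h1 h2; apply: nj3; exists j].
(* If k = x + y = z + w were a root, then (k,k) > 0 would be the sum of the four products between
   {x, y} and {z, w}; a positive one would give a root difference, already excluded. *)
rewrite !(subr0, addr0, oppr0); apply: direct_coef0 => k; apply/negP => /eqP kE.
have : 0 < <<e_ k, e_ k>> by exact: proot_dot_gt0.
rewrite {2}kE E {1}kE dotD !dotDr => kk.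
have [xw0|xw0] := ltP 0 <<e_ x, e_ w>>.
  have [m [H|H]] := proot_sub xw xw0.
    by apply: nj'; exists m; apply: (addrI (e_ w)); rewrite addrC -E H addrAC addrA.
  by apply: nj3; exists m; apply: (addrI (e_ x)); rewrite E H addrCA.
have [yw0|yw0] := ltP 0 <<e_ y, e_ w>>.
  have [m [H|H]] := proot_sub yw yw0.
    by apply: nj; exists m; apply: (addrI (e_ w)); rewrite addrC -E' H addrAC addrA.
  by apply: nj''; exists m; apply: (addrI (e_ y)); rewrite E' H addrCA.
by move: xz0 yz0 xw0 yw0 kk; clear; lra.
Qed.

Lemma curv_sum_neq x y z w : e_ x + e_ y != e_ z + e_ w -> curv x y z w = 0.
Proof.
move=> ne.
have C0 a b a' b' : e_ a + e_ b != e_ a' + e_ b' -> C a b a' b' = 0.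
  move=> H; apply/eqP; apply: contraNT H => /cross_coef_neq0[j [-> ->]].
  by rewrite addrAC [eqbRHS]addrAC [e_ b' + _]addrC.
have ne' : e_ y + e_ x != e_ z + e_ w by rewrite addrC.
rewrite /curv (C0 x y z w) // (C0 y x z w) // !(C0 _ _ w z) 1?[e_ w + _]addrC //.
rewrite !(subr0, addr0); apply: big1 => l _; apply/eqP; apply: contraNT ne.
by rewrite mulf_eq0 negb_or => /andP[/lie_coef_neq0 <- /lie_coef_neq0 <-].
Qed.

Local Notation ext := (ext N).
Local Notation E := (@create N).
Local Notation A := (@annihilate N).
Local Notation dd := (ce_d E A c).
Local Notation dl := (ce_delta E A c).

(** The entries stay anonymous, so that diagonality passes through sums and sandwiches structurally;
    their values are computed afterwards from the matrix of d. *)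
Definition is_diag (F : ext -> ext) :=
  exists g : {set 'I_N} -> int, forall v t, F v t = g t * v t.

Lemma is_diag_sum (I : finType) (F : I -> ext -> ext) :
  (forall a, is_diag (F a)) -> is_diag (fun v => \sum_a F a v).
Proof.
move=> /choice[g gE]; exists (fun t => \sum_a g a t) => v t.
by rewrite sum_ffunE mulr_suml; apply: eq_bigr => a _; rewrite gE.
Qed.

Lemma is_diagMz (F : ext -> ext) (n : int) : is_diag F ->
  is_diag (fun v => F v *~ n).
Proof.
by move=> [g gE]; exists (fun t => g t * n) => v t; rewrite ext_mulrzE gE mulrAC.
Qed.

Lemma is_diagN (F : ext -> ext) : is_diag F -> is_diag (fun v => - F v).
Proof. by move=> [g gE]; exists (fun t => - g t) => v t;
  rewrite ffunE gE mulNr. Qed.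

Lemma is_diagD (F G : ext -> ext) :
  is_diag F -> is_diag G -> is_diag (fun v => F v + G v).
Proof.
by move=> [g gE] [h hE]; exists (fun t => g t + h t) => v t;
  rewrite ffunE gE hE mulrDl.
Qed.

Lemma is_diag_ext (F G : ext -> ext) : F =1 G -> is_diag F -> is_diag G.
Proof. by move=> FG [g gE]; exists g => v t; rewrite -FG. Qed.

Lemma is_diag_create_annihilate k (F : ext -> ext) :
  is_diag F -> is_diag (fun v => E k (F (A k v))).
Proof.
move=> [g gE]; exists (fun t => if k \in t then g (t :\ k) else 0) => v t.
by rewrite (create_diag_annihilate _ _ _ gE); case: ifP; rewrite ?mul0r.
Qed.

(** A nonzero coefficient forces {x, y} = {z, w}; up to sign the monomial is then
    [E a (E b (A b (A a v)))], which multiplies each basis set by 0 or 1. *)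
Lemma is_diag_quartic x y z w :
  is_diag (fun v => E z (E w (A y (A x v))) *~ curv x y z w).
Proof.
have [->|nz] := eqVneq (curv x y z w) 0.
  by exists (fun _ => 0) => v t; rewrite mulr0z ffunE mul0r.
apply: is_diagMz.
have sE : e_ x + e_ y = e_ z + e_ w.
  by apply/eqP; apply: contraNT nz => /curv_sum_neq->.
have D a b : is_diag (fun v => E a (E b (A b (A a v)))).
  apply: (@is_diag_create_annihilate _ (fun v => E b (A b v))).
  by apply: (@is_diag_create_annihilate _ id); exists (fun _ => 1) => v t;
    rewrite mul1r.
have D' a b : is_diag (fun v => E b (E a (A b (A a v)))).
  by apply: is_diag_ext (is_diagN (D a b)) => v; rewrite createC opprK.
have inj := @proot_inj _ _ _ P.
have [xz|xz] := eqVneq x z.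
  by rewrite xz in sE *; move/addrI/inj: sE => ->.
have [xw|xw] := eqVneq x w.
  by rewrite xw addrC in sE *; move/addIr/inj: sE => ->.
have [yz|yz] := eqVneq y z.
  by rewrite yz addrC in sE xw *; move/addrI/inj: sE xw => ->; rewrite eqxx.
have [yw|yw] := eqVneq y w.
  by rewrite yw in sE xz *; move/addIr/inj: sE xz => ->; rewrite eqxx.
by rewrite curv_eq0 ?eqxx in nz.
Qed.

(** The monomials are antisymmetric in x, y and in z, w, so only the antisymmetrized coefficient
    counts. Taking four copies turns [lap_coef4] into 4 [curv] without any division. *)
Lemma lap_is_diag : is_diag (fun v => (dd (dl v) + dl (dd v)) *+ 4).
Proof.
pose X z w y x v := E z (E w (A y (A x v))).
pose Q v := \sum_z \sum_w \sum_y \sum_x X z w y x v *~ curv x y z w.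
pose K v := \sum_l \sum_p E l (A p v) *~ lap_coef2 c l p.
suff H v : K v *~ 8 + Q v *~ 4 = (dd (dl v) + dl (dd v)) *+ 4.
  apply: is_diag_ext H _; apply: is_diagD; apply: is_diagMz.
    apply: is_diag_sum => l; apply: is_diag_sum => p.
    have [->|lp] := eqVneq l p.
      apply: is_diagMz; apply: (@is_diag_create_annihilate _ id).
      by exists (fun _ => 1) => u t; rewrite mul1r.
    exists (fun _ => 0) => u t; rewrite mul0r [X in _ *~ X]big1 ?mulr0z ?ffunE //.
    move=> m _; apply: big1 => n _; apply/eqP; apply: contraNT lp.
    rewrite mulf_eq0 negb_or => /andP[/lie_coef_neq0 h1 /lie_coef_neq0 h2].
    by apply/eqP/(@proot_inj _ _ _ P); rewrite h1 h2.
  do 4![apply: is_diag_sum => ?]; exact: is_diag_quartic.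
rewrite (ce_lapE (@createC _) (@annihilateC _) (@annihilate_create _)
  (lie_coef_skew L)).
rewrite mulrnDl -mulrnA -/(K v); congr (_ + _).
pose G := lap_coef4 c; pose SS F :=
  \sum_z \sum_w \sum_y \sum_x X z w y x v *~ F x y z w.
have SSl F : SS F = - SS (fun x y z w => F y x z w).
  rewrite /SS -sumrN; apply: eq_bigr => z _; rewrite -sumrN; apply: eq_bigr => w _.
  rewrite exchange_big -sumrN; apply: eq_bigr => y _; rewrite -sumrN.
  apply: eq_bigr => x _; rewrite /X /= annihilateC !raddfN /= mulNrz.
  by [].
have SSr F : SS F = - SS (fun x y z w => F x y w z).
  rewrite /SS exchange_big -sumrN; apply: eq_bigr => z _; rewrite -sumrN;
    apply: eq_bigr => w _.
  rewrite -sumrN; apply: eq_bigr => y _; rewrite -sumrN.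
  by apply: eq_bigr => x _; rewrite /X createC mulNrz.
have SSD F F' : SS F + SS F' = SS (fun x y z w => F x y z w + F' x y z w).
  rewrite /SS; do 4![rewrite -big_split /=; apply: eq_bigr => ? _].
  by rewrite mulrzDr.
have SSN F : - SS F = SS (fun x y z w => - F x y z w).
  rewrite /SS; do 4![rewrite -sumrN /=; apply: eq_bigr => ? _].
  by rewrite mulrNz.
rewrite -[\sum_z _]/(SS G).
have -> : SS G *+ 4 = SS (fun x y z w => G x y z w - G y x z w - G x y w z + G
  y x w z).
  have h1 : SS G = SS (fun x y z w => - G y x z w) by rewrite {1}SSl SSN.
  have h2 : SS G = SS (fun x y z w => - G x y w z) by rewrite {1}SSr SSN.
  have h3 : SS G = SS (fun x y z w => G y x w z) by rewrite {1}SSl SSr opprK.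
  by rewrite !mulrS mulr0n addr0 !addrA {2}h1 {2}h2 {2}h3 !SSD.
have -> : Q v *~ 4 = SS (fun x y z w => curv x y z w *+ 4).
  rewrite /Q mulrz_suml; do 3![apply: eq_bigr => ? _; rewrite mulrz_suml].
  by apply: eq_bigr => ? _; rewrite -mulrzA mulr_natr.
have GE x y z w : G x y z w = T x y z w - C x y z w *+ 4.
  by congr (_ - _); apply: eq_bigr => l _; rewrite mulrC.
have Tl x y z w : T y x z w = - T x y z w.
  by rewrite -sumrN; apply: eq_bigr => l _; rewrite lie_coef_skew mulNr.
have Tr x y z w : T x y w z = - T x y z w.
  by rewrite -sumrN; apply: eq_bigr => l _; rewrite [c w z l]lie_coef_skew mulrN.
apply: eq_bigr => z _; apply: eq_bigr => w _; apply: eq_bigr => y _.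
apply: eq_bigr => x _; congr (_ *~ _); rewrite !GE /curv.
by rewrite (Tl x y z w) (Tl x y w z) (Tr x y z w); ring.
Qed.

(** * Matrix entries of d and the basis graph *)

Local Notation dc := (dcoef (lbr L)).

Definition fuses s t := [exists i, exists j, exists k,
  [&& e_ k == e_ i + e_ j, s :\: t == [set i; j] & t :\: s == [set k]]].

Lemma pair_sum (v w : ext) : \sum_t v t * w t = \sum_t w t * v t.
Proof. by apply: eq_bigr => t _; rewrite mulrC. Qed.

Lemma ce_adj (u v : ext) : \sum_t dd u t * v t = \sum_t u t * dl v t.
Proof.
rewrite /ce_d /ce_delta /sum3.
transitivity (\sum_i \sum_j \sum_l \sum_t E l (A j (A i u)) t * v t * c i j l).
  under eq_bigr => t _.
    rewrite sum_ffunE mulr_suml.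
    under eq_bigr => i _.
      rewrite sum_ffunE mulr_suml.
      under eq_bigr => j _.
        rewrite sum_ffunE mulr_suml.
        under eq_bigr => l _ do rewrite ext_mulrzE mulrAC.
        over.
      over.
    over.
  rewrite exchange_big; apply: eq_bigr => i _.
  by rewrite exchange_big; apply: eq_bigr => j _; rewrite exchange_big.
transitivity (\sum_i \sum_j \sum_l \sum_t u t * E i (E j (A l v)) t * c i j l).
  do 3![apply: eq_bigr => ? _]; rewrite -!mulr_suml; congr (_ * _).
  by rewrite create_adj pair_sum -create_adj -create_adj pair_sum.
symmetry; under eq_bigr => t _.
  rewrite sum_ffunE mulr_sumr.
  under eq_bigr => i _.
    rewrite sum_ffunE mulr_sumr.
    under eq_bigr => j _.
      rewrite sum_ffunE mulr_sumr.
      under eq_bigr => l _ do rewrite ext_mulrzE mulrA.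
      over.
    over.
  over.
rewrite exchange_big; apply: eq_bigr => i _.
by rewrite exchange_big; apply: eq_bigr => j _; rewrite exchange_big.
Qed.

Lemma pair_basisl s (v : ext) : \sum_t ext_basis s t * v t = v s.
Proof.
rewrite (bigD1 s) //= ffunE eqxx mul1r big1 ?addr0 // => t /negPf ts.
by rewrite ffunE ts mul0r.
Qed.

Lemma ce_d_basis s t : dd (ext_basis s) t = 2 * dc s t.
Proof.
rewrite -ext_prod_enum (ce_d_prod (lie_coef_skew L)) ffunMnE.
by rewrite mulr_natl.
Qed.

Lemma ce_deltaE (v : ext) s : dl v s = 2 * \sum_t dc s t * v t.
Proof.
rewrite -pair_basisl -ce_adj mulr_sumr; apply: eq_bigr => t _.
by rewrite ce_d_basis mulrA.
Qed.

Lemma ce_dE_sum (v : ext) t : dd v t = 2 * \sum_s dc s t * v s.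
Proof.
rewrite -pair_basisl pair_sum ce_adj mulr_sumr; apply: eq_bigr => s _.
rewrite mulrC ce_deltaE -mulrA; congr (_ * (_ * _)).
by rewrite pair_sum pair_basisl.
Qed.

Lemma dcoef_sq0 s t : \sum_u dc s u * dc u t = 0.
Proof.
have := ce_dd (@createC _) (@annihilateC _) (@annihilate_create _)
  (lie_coef_skew L) (lie_coef_jacobi L) (ext_basis s).
move/(congr1 (fun v : ext => v t)); rewrite ffunMnE ce_dE_sum.
under eq_bigr => u _ do rewrite ce_d_basis mulrCA mulrC [dc u t * _]mulrC.
rewrite -mulr_suml ffunE => /eqP.
by rewrite mulrn_eq0 !mulf_eq0 /= orbF => /eqP.
Qed.

Lemma dcoef_lap_offdiag s t : s != t ->
  \sum_u (dc u s * dc u t + dc s u * dc t u) = 0.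
Proof.
move=> st; have [g /(_ (ext_basis s) t)] := lap_is_diag.
rewrite [ext_basis s t]ffunE eq_sym (negPf st) mulr0 ffunMnE ffunE.
rewrite ce_dE_sum ce_deltaE.
under eq_bigr => u _ do rewrite ce_deltaE pair_sum pair_basisl mulrCA.
under [in X in _ + X]eq_bigr => u _ do rewrite ce_d_basis mulrCA.
rewrite -!mulr_sumr big_split /= => H.
rewrite (eq_bigr (fun u => dc u t * dc u s)); last by move=> u _; rewrite mulrC.
rewrite [X in _ + X](eq_bigr (fun u => dc t u * dc s u)); last by move=> u _;
  rewrite mulrC.
by move/eqP: H; rewrite -!mulrDr mulrn_eq0 !mulf_eq0 /= => /eqP.
Qed.

(** The sign is left unspecified because only its square will enter. *)
Lemma create_annihilate2_basis i j k s t : exists2 eps : int, eps * eps = 1 &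
  E k (A j (A i (ext_basis s))) t = eps *
    [&& k \in t, j \notin t :\ k, i \notin j |: t :\ k & i |: (j |: t :\ k) ==
      s]%:R.
Proof.
exists (ext_sign k t * (ext_sign j (t :\ k) * ext_sign i (j |: t :\ k))).
  by rewrite mulrACA ext_sign2 mul1r mulrACA !ext_sign2.
rewrite !ffunE; case: (k \in t); last by rewrite mulr0.
case: (j \in t :\ k); first by rewrite /= !mulr0.
by case: (i \in j |: t :\ k); rewrite /= ?mulr0 // !mulrA.
Qed.

Lemma fuses_cond i j k s t : k != i -> k != j ->
  [&& k \in t, j \notin t :\ k, i \notin j |: t :\ k & i |: (j |: t :\ k) == s] =
  [&& i != j, s :\: t == [set i; j] & t :\: s == [set k]].
Proof.
move=> ki kj; apply/idP/idP.
  case/and4P => kt jt it /eqP <-.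
  move: jt it; rewrite !inE negb_or eq_sym kj /= => jt /andP[ij].
  rewrite eq_sym ki /= => it; rewrite ij /=; apply/andP; split;
    apply/eqP/setP => m; rewrite !inE.
    have [->|mi] /= := eqVneq m i; first by rewrite it.
    have [->|mj] /= := eqVneq m j; first by rewrite jt.
    by case: (m \in t); rewrite ?andbF.
  have [->|mk] /= := eqVneq m k; first by rewrite (negPf ki) (negPf kj) kt.
  by case: (m \in t); rewrite ?andbF // ?orbT.
case/and3P => ij /eqP/setP st /eqP/setP ts.
have := ts k; rewrite !inE eqxx => /andP[ks kt].
have := st i; rewrite !inE eqxx => /andP[it si].
have := st j; rewrite !inE eqxx orbT => /andP[jt sj].
rewrite kt (negPf jt) andbF (negPf it) andbF orbF ij /=; apply/eqP/setP => m.
rewrite !inE; have := st m; have := ts m; rewrite !inE.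
have [->|mi] /= := eqVneq m i; first by rewrite si.
have [->|mj] /= := eqVneq m j; first by rewrite sj.
have [->|mk] /= := eqVneq m k; first by rewrite (negPf ks).
by case: (m \in t); case: (m \in s).
Qed.

Lemma proot_sum_neq i j k : e_ k = e_ i + e_ j -> [/\ k != i, k != j & i != j].
Proof.
move=> kE; have nz (m : 'I_N) : e_ m != 0 := root_neq0 (proot_root m).
split.
- by apply: contra (nz j) => /eqP ki; rewrite -(inj_eq (addrI (e_ i))) addr0 -kE ki.
- by apply: contra (nz i) => /eqP kj; rewrite -(inj_eq (addIr (e_ j))) add0r -kE kj.
(* For i = j the structure constant would be its own negative, yet it is 1 or -1. *)
- apply/negP => /eqP ij; have := lie_coefP L kE; have := lie_coef_skew L i j k.
  by rewrite ij; lia.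
Qed.

Lemma dcoef_term_neq0 i j k s t : E k (A j (A i (ext_basis s))) t * c i j k != 0 ->
  [/\ e_ k = e_ i + e_ j, s :\: t = [set i; j] & t :\: s = [set k]].
Proof.
have [eps _ ->] := create_annihilate2_basis i j k s t.
rewrite !mulf_eq0 !negb_or => /andP[/andP[_ +] /lie_coef_neq0 kE].
have [ki kj ij] := proot_sum_neq kE; rewrite (fuses_cond _ _ ki kj) ij /=.
by case: (s :\: t =P _) => //=; case: (t :\: s =P _).
Qed.

Lemma fusesP s t : reflect (exists i j k,
  [/\ e_ k = e_ i + e_ j, s :\: t = [set i; j] & t :\: s = [set k]]) (fuses s t).
Proof.
apply: (iffP existsP) => [[i /existsP[j /existsP[k /and3P[/eqP h1 /eqP h2 /eqP
  h3]]]]|].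
  by exists i, j, k.
case=> i [j [k [h1 h2 h3]]]; exists i; apply/existsP; exists j; apply/existsP.
by exists k; rewrite h1 h2 h3 !eqxx.
Qed.

Lemma ce_d_basis_sum s t : 2 * dc s t =
  \sum_i \sum_j \sum_k E k (A j (A i (ext_basis s))) t * c i j k.
Proof.
rewrite -ce_d_basis /ce_d /sum3 sum_ffunE; apply: eq_bigr => i _.
rewrite sum_ffunE; apply: eq_bigr => j _; rewrite sum_ffunE.
by apply: eq_bigr => k _; rewrite ext_mulrzE.
Qed.

(** The orders (i0, j0) and (j0, i0) contribute equally, since annihilators and structure constants
    both change sign, and no other triple contributes. The 2 of the doubled operator thus cancels
    and one sign remains. *)
Lemma dcoef_sqr s t : dc s t * dc s t = (fuses s t)%:R.
Proof.
pose X i j k := E k (A j (A i (ext_basis s))) t * c i j k.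
have dcE := ce_d_basis_sum s t; rewrite -/(X _ _ _) in dcE.
case: fusesP => [[i0 [j0 [k0 [kE st ts]]]]|nm]; last first.
  suff -> : dc s t = 0 by rewrite mul0r.
  have : 2 * dc s t = 0.
    rewrite dcE big1 // => i _; rewrite big1 // => j _; rewrite big1 // => k _.
    by apply/eqP; apply: contraPT nm => /dcoef_term_neq0 H; case; exists i, j, k.
  by lia.
have [ki kj ij] := proot_sum_neq kE.
have Xsym : X j0 i0 k0 = X i0 j0 k0.
  by rewrite /X annihilateC raddfN /= ffunE lie_coef_skew mulrNN.
have dcX : dc s t = X i0 j0 k0.
  have : 2 * dc s t = X i0 j0 k0 + X j0 i0 k0.
    have X0 i j k : X i j k != 0 -> [&& k == k0, (i == i0) || (i == j0) &
        (j == if i == i0 then j0 else i0)].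
      move=> /dcoef_term_neq0[h1]; rewrite st ts => /setP sE /set1_inj <-.
      have := sE i; have := sE j; rewrite !inE !eqxx orbT /= => hj hi.
      rewrite hi /=; have [_ _ +] := proot_sum_neq h1.
      move: hi hj; have [->|_] /= := eqVneq i i0.
        by move=> _ /orP[/eqP->|]; rewrite ?eqxx.
      by move=> /eqP-> /orP[|/eqP->]; rewrite ?eqxx.
    have inner i j : (i == i0) || (i == j0) -> j = (if i == i0 then j0 else i0) ->
        \sum_j \sum_k X i j k = X i j k0.
      move=> hi hj; rewrite (bigD1 j) //= (bigD1 k0) //= big1 => [|k kk0].
        rewrite big1 ?addr0 // => m mj; apply: big1 => k _; apply/eqP.
        by apply: contraNT mj => /X0/and3P[_ _]; rewrite -hj.
      by apply/eqP; apply: contraNT kk0 => /X0/and3P[].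
    rewrite dcE (bigD1 i0) //= [X in _ + X](bigD1 j0) 1?eq_sym //=.
    rewrite (inner i0 j0) ?eqxx //.
    rewrite (inner j0 i0) ?eqxx ?orbT 1?eq_sym ?(negPf ij) //.
    rewrite big1 ?addr0 // => i /andP[ii0 ij0].
    rewrite big1 // => j _; rewrite big1 // => k _; apply/eqP.
    by apply: contraNT ii0 => /X0/and3P[_]; rewrite (negPf ij0) orbF.
  by rewrite Xsym; lia.
rewrite dcX /X; have [eps eps2 ->] := create_annihilate2_basis i0 j0 k0 s t.
rewrite (fuses_cond _ _ ki kj) ij st ts !eqxx mulr1 mulrACA eps2 mul1r.
by case: (lie_coefP L kE) => ->.
Qed.

Lemma dcoef_neq0 s t : (dc s t != 0) = fuses s t.
Proof. by have := dcoef_sqr s t; case: (fuses s t) => /=; lia. Qed.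

Lemma fuses_card s t : fuses s t -> #|s| = #|t|.+1.
Proof.
case/fusesP => i [j [k [/proot_sum_neq[_ _ ij] st ts]]].
by rewrite -(cardsID t s) -[in RHS](cardsID s t) st ts cards2 ij cards1 setIC addnS.
Qed.

Lemma fuses_weight s t : fuses s t -> weight s = weight t.
Proof.
case/fusesP => i [j [k [kE st ts]]]; have [_ _ ij] := proot_sum_neq kE.
rewrite /weight (big_setID t) /= [X in _ = _ - X](big_setID s) /= setIC.
by rewrite st ts big_set1 big_setU1 ?inE //= big_set1 kE.
Qed.

Lemma basis_edgeE s t : basis_edge s t = fuses s t || fuses t s.
Proof.
apply/existsP/orP => [[k /existsP[i /existsP[j /andP[/eqP kE /orP[]/andP[/eqP
  h1 /eqP h2]]]]]|].
- by right; apply/fusesP; exists i, j, k.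
- by left; apply/fusesP; exists i, j, k.
case=> /fusesP[i [j [k [h1 h2 h3]]]]; exists k; apply/existsP; exists i;
  by apply/existsP; exists j; rewrite h1 h2 h3 !eqxx ?orbT.
Qed.

Definition deg s := degree (weight s) s.

(** Squares of entries of d are 0 or 1 and so count neighbours; cardinality prevents an edge from
    being counted in both orientations. *)
Lemma dcoef_lap_diag s : \sum_u (dc u s * dc u s + dc s u * dc s u) = (deg s)%:R.
Proof.
rewrite /deg /degree -sum1dep_card natr_sum [RHS]big_mkcond; apply: eq_bigr => u _.
rewrite !dcoef_sqr basis_edgeE.
case us: (fuses u s); case su: (fuses s u); rewrite /= ?andbF //.
- by have := fuses_card us; have := fuses_card su; lia.
- by rewrite (fuses_weight us) eqxx.
- by rewrite (fuses_weight su) eqxx.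
Qed.

Lemma dcoef_lap s t :
  \sum_u (dc u s * dc u t + dc s u * dc t u) = if s == t then (deg s)%:R else 0.
Proof.
by case: eqVneq => [->|/dcoef_lap_offdiag//]; apply: dcoef_lap_diag.
Qed.

(* Because d d = 0, the diagonal Laplacian commutes with d. *)
Lemma deg_fuses s t : fuses s t -> deg s = deg t.
Proof.
rewrite -dcoef_neq0 => st.
pose l s t := \sum_u (dc u s * dc u t + dc s u * dc t u).
have h1 : \sum_u l s u * dc u t = (deg s)%:R * dc s t.
  rewrite (bigD1 s) //= big1 ?addr0 => [|u us]; rewrite /l dcoef_lap ?eqxx //.
  by rewrite eq_sym (negPf us) mul0r.
have h2 : \sum_u dc s u * l u t = dc s t * (deg t)%:R.
  rewrite (bigD1 t) //= big1 ?addr0 => [|u us]; rewrite /l dcoef_lap ?eqxx //.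
  by rewrite (negPf us) mulr0.
suff : (deg s)%:R * dc s t = dc s t * (deg t)%:R by rewrite mulrC;
  move/(mulfI st); lia.
rewrite -h1 -h2 /l.
(* Both sides are the entry of d delta d; the other half of each Laplacian contains d d. *)
transitivity (\sum_u \sum_v dc s v * (dc u v * dc u t)).
  under eq_bigr => u _ do rewrite mulr_suml.
  under eq_bigr => u _ do under eq_bigr => v _ do rewrite mulrDl.
  under eq_bigr => u _ do rewrite big_split /=.
  rewrite big_split /= [X in X + _]exchange_big /= big1 ?add0r => [|v _].
    by apply: eq_bigr => u _; apply: eq_bigr => v _; rewrite mulrA.
  under eq_bigr => u _ do rewrite -mulrA.
  by rewrite -mulr_sumr dcoef_sq0 mulr0.
under [RHS]eq_bigr => u _ do rewrite mulr_sumr.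
under [RHS]eq_bigr => u _ do under eq_bigr => v _ do rewrite mulrDr.
under [RHS]eq_bigr => u _ do rewrite big_split /=.
rewrite big_split /= [X in _ + X]exchange_big /= [X in _ + X]big1 ?addr0 => [|v _].
  exact: exchange_big.
under eq_bigr => u _ do rewrite mulrA.
by rewrite -mulr_suml dcoef_sq0 mul0r.
Qed.

End Laplacian.

(** * The degree depends only on the weight *)

Section Connected.
Variables (R : realType) (V : vectType R) (S : rootSystem V).
Variable P : positiveSystem S.
Variable L : rootLie P.
Local Notation N := (npos P).
Local Notation e_ := (@proot _ _ _ P).
Local Notation "<< u , v >>" := (dot S u v).
Local Notation f := (pos_fun P).
Implicit Types i j k a b : 'I_N.
Implicit Types s t : {set 'I_N}.

Local Notation wsum M := (\sum_(i <- M) e_ i).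

Lemma wsum_gt0 (M : seq 'I_N) : (0 < size M)%N -> 0 < f (wsum M).
Proof.
case: M => // a M _; rewrite big_cons linearD /= linear_sum.
apply: ltr_wpDr; last exact: proot_gt0.
by apply: sumr_ge0 => i _; apply/ltW/proot_gt0.
Qed.

Lemma wsum_neq0 (M : seq 'I_N) : (0 < size M)%N -> wsum M != 0.
Proof. by move/wsum_gt0; apply: contraTneq => ->; rewrite linear0 ltxx. Qed.

Lemma sum_gt0_ex (I : eqType) (r : seq I) (F : I -> R) :
  0 < \sum_(i <- r) F i -> exists2 i, i \in r & 0 < F i.
Proof.
elim: r => [|i r IH]; first by rewrite big_nil ltxx.
rewrite big_cons; have [Fi|Fi] := ltP 0 (F i).
  by exists i; rewrite ?mem_head.
move=> H; case: IH; first by lra.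
by move=> j jr Fj; exists j; rewrite // inE jr orbT.
Qed.

Lemma wsum_rem a (M : seq 'I_N) : a \in M -> wsum M = e_ a + wsum (rem a M).
Proof. by move=> aM; rewrite (perm_big _ (perm_to_rem aM)) big_cons. Qed.

(* If every pair a in A, b in B with (a, b) > 0 had its difference in A or in B,
   replacing such a pair by the difference would shorten the equation
   sum M = sum M' between multisets of A and B for ever. *)
Lemma exchange_pair (A B : {set 'I_N}) n (M M' : seq 'I_N) :
  [disjoint A & B] -> (size M + size M' <= n)%N -> (0 < size M + size M')%N ->
  {subset M <= A} -> {subset M' <= B} -> wsum M = wsum M' ->
  exists a b k, [/\ a \in A, b \in B &
    (e_ a = e_ b + e_ k /\ k \notin A) \/ (e_ b = e_ a + e_ k /\ k \notin B)].
Proof.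
move=> AB; elim: n M M' => [|n IH] M M' sz sz0 MA MB MM'.
  by move: sz0; rewrite lt0n -leqn0 sz.
have M0 : (0 < size M)%N.
  rewrite lt0n size_eq0; apply/eqP => ME; move: sz0 MM'; rewrite ME add0n big_nil.
  by move/wsum_neq0 => /negP H /esym/eqP.
have M0' : (0 < size M')%N.
  rewrite lt0n size_eq0; apply/eqP => ME; move: MM'; rewrite ME big_nil => /eqP.
  exact/negP/wsum_neq0.
have : 0 < <<wsum M, wsum M'>> by rewrite -MM' dot_gt0 // wsum_neq0.
rewrite dot_suml => /sum_gt0_ex[a aM]; rewrite dot_sumr => /sum_gt0_ex[b bM' ab].
have aA := MA a aM; have bB := MB b bM'.
have ne : a != b.
  by apply: contraTneq bB => <-; rewrite (disjointFr AB aA).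
have sM : size (rem a M) = (size M).-1 by rewrite size_rem.
have sM' : size (rem b M') = (size M').-1 by rewrite size_rem.
have MM2 := MM'; rewrite (wsum_rem aM) (wsum_rem bM') in MM2.
have [k [E|E]] := proot_sub ne ab.
  have [kA|kA] := boolP (k \in A); last by exists a, b, k; split=> //; left.
  apply: (IH (k :: rem a M) (rem b M')).
  - by rewrite /= sM sM'; move: sz M0 M0'; clear; lia.
  - by [].
  - by move=> i; rewrite inE => /orP[/eqP->//|/mem_rem/MA].
  - by move=> i /mem_rem/MB.
  - by rewrite big_cons; apply: (addrI (e_ b)); rewrite addrA -E.
have [kB|kB] := boolP (k \in B); last by exists a, b, k; split=> //; right.
apply: (IH (rem a M) (k :: rem b M')).
- by rewrite /= sM sM'; move: sz M0 M0'; clear; lia.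
- by rewrite addnS.
- by move=> i /mem_rem/MA.
- by move=> i; rewrite inE => /orP[/eqP->//|/mem_rem/MB].
- by rewrite big_cons; apply: (addrI (e_ a)); rewrite addrA -E.
Qed.

Lemma fuses_set i j k s : e_ k = e_ i + e_ j -> i \in s -> j \in s -> k \notin s ->
  fuses s (k |: s :\ i :\ j).
Proof.
move=> kE si sj sk; have [ki kj ij] := proot_sum_neq L kE.
apply/fusesP; exists i, j, k; split=> //; apply/setP => m; rewrite !inE.
  have [->|mk] /= := eqVneq m k.
    by rewrite (negPf ki) (negPf kj).
  have [->|mi] /= := eqVneq m i; first by rewrite si andbF.
  have [->|mj] /= := eqVneq m j; first by rewrite sj.
  by case: (m \in s).
have [->|mk] /= := eqVneq m k; first by rewrite sk.
by case: (m \in s); rewrite ?andbF.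
Qed.

Lemma split_set i j k s : e_ k = e_ i + e_ j -> k \in s -> i \notin s ->
  j \notin s ->
  fuses (i |: (j |: s :\ k)) s.
Proof.
move=> kE sk si sj; have [ki kj ij] := proot_sum_neq L kE.
apply/fusesP; exists i, j, k; split=> //; apply/setP => m; rewrite !inE.
  have [->|mi] /= := eqVneq m i; first by rewrite si.
  have [->|mj] /= := eqVneq m j; first by rewrite sj.
  by have [->|mk] /= := eqVneq m k; rewrite ?sk //; case: (m \in s).
have [->|mk] /= := eqVneq m k; first by rewrite (negPf ki) (negPf kj) sk.
by case: (m \in s); rewrite ?andbF // !orbT.
Qed.

Definition sdist s t := (#|s :\: t| + #|t :\: s|)%N.

(** If k lies in s it also lies in t, and b, k are fused to a in t; otherwise a is split into b, k
    in s. Either way a and b leave the symmetric difference and at most k enters it. *)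
Lemma sdist_decr a b k s t : a \in s :\: t -> b \in t :\: s ->
  e_ a = e_ b + e_ k -> k \notin s :\: t ->
  exists s' t', [/\ deg s' = deg s, deg t' = deg t, weight s' = weight s,
    weight t' = weight t & (sdist s' t' < sdist s t)%N].
Proof.
move=> aA bB aE kA.
suff [s' [t' [h1 h2 h3 h4 [h5 h6]]]] : exists s' t', [/\ deg s' = deg s,
    deg t' = deg t, weight s' = weight s, weight t' = weight t &
    s' :\: t' \subset k |: (s :\: t) :\ a /\ t' :\: s' \subset (t :\: s) :\ b].
  exists s', t'; split => //; rewrite /sdist.
  rewrite -addnS leq_add //.
    rewrite (leq_trans (subset_leq_card h5)) // cardsU1 (cardsD1 a (s :\: t)) aA.
    by rewrite leq_add2r leq_b1.
  by rewrite [X in (_ < X)%N](cardsD1 b) bB ltnS subset_leq_card.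
move: (aA) (bB); rewrite !inE => /andP[ta sa] /andP[sb tb].
have [/negPf ab /negPf ak /negPf bk] := proot_sum_neq L aE.
have [ba ka kb] : [/\ (b == a) = false, (k == a) = false & (k == b) = false].
  by rewrite ![_ == a]eq_sym [k == b]eq_sym ab ak bk.
have [sk|sk] := boolP (k \in s).
  have tk : k \in t by move: kA; rewrite !inE sk andbT negbK.
  have m := fuses_set aE tb tk ta.
  exists s, (a |: t :\ b :\ k); split=> //; first exact/esym/(deg_fuses L m).
    exact/esym/(fuses_weight L m).
  split; apply/subsetP => x; rewrite !inE;
  (case: (eqVneq x a) => [->|_]; first by rewrite ?eqxx ?sa ?(negPf ta) ?ab ?ak
    /= ?andbF ?orbF);
  (case: (eqVneq x b) => [->|_]; first by rewrite ?eqxx ?tb ?(negPf sb) ?bk ?ba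
    /= ?andbF ?orbF);
  (case: (eqVneq x k) => [->|_]; first by rewrite ?eqxx ?sk ?tk ?ka ?kb /=
    ?andbF ?orbF);
  by case: (x \in s); case: (x \in t).
have m := split_set aE sa sb sk.
exists (b |: (k |: s :\ a)), t; split=> //; first exact: (deg_fuses L m).
  exact: (fuses_weight L m).
split; apply/subsetP => x; rewrite !inE;
  (case: (eqVneq x a) => [->|_]; first by rewrite ?eqxx ?sa ?(negPf ta) ?ab ?ak
    /= ?andbF ?orbF);
  (case: (eqVneq x b) => [->|_]; first by rewrite ?eqxx ?tb ?(negPf sb) ?bk ?ba
    /= ?andbF ?orbF);
  (case: (eqVneq x k) => [->|_]; first by rewrite ?eqxx ?(negPf sk) ?ka ?kb /=
    ?andbF ?orbF);
  by case: (x \in s); case: (x \in t).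
Qed.

(** This expresses the connectedness of the graph of a weight: s and t approach each other along
    edges, which preserve [deg], until they coincide. *)
Lemma deg_weight s t : weight s = weight t -> deg s = deg t.
Proof.
have [n] := ubnP (sdist s t); elim: n s t => // n IH s t; rewrite ltnS => sz w.
have [/eqP|d0] := eqVneq (sdist s t) 0%N.
  rewrite addn_eq0 !cards_eq0 !setD_eq0 => st; congr deg.
  by apply/eqP; rewrite eqEsubset.
have AB : [disjoint s :\: t & t :\: s].
  by rewrite -setI_eq0; apply/eqP/setP => x; rewrite !inE; case: (x \in s);
    rewrite ?andbF.
have [||||a [b [k [aA bB H]]]] :=
  @exchange_pair _ _ _ (enum (s :\: t)) (enum (t :\: s)) AB (leqnn _).
- by rewrite -!cardE lt0n.
- by move=> x; rewrite mem_enum.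
- by move=> x; rewrite mem_enum.
- rewrite !big_enum /=; move: w;
  rewrite /weight (big_setID t) [X in _ = _ - X](big_setID s).
  by rewrite /= setIC => /addrI/oppr_inj/addrI.
have [s' [t' [h1 h2 h3 h4 h5]]] : exists s' t', [/\ deg s' = deg s, deg t' = deg t,
    weight s' = weight s, weight t' = weight t & (sdist s' t' < sdist s t)%N].
  case: H => [[E kA]|[E kB]]; first exact: sdist_decr aA bB E kA.
  have [t' [s' [h1 h2 h3 h4 h5]]] := sdist_decr bB aA E kB.
  exists s', t'; split => //.
  by rewrite /sdist addnC (leq_trans h5) // addnC.
by rewrite -h1 -h2; apply: IH; [exact: leq_trans h5 sz|rewrite h3 h4].
Qed.

Lemma rank_weight s : rank P (weight s) = deg s.
Proof.
rewrite /rank; case: pickP => [t /eqP E|/(_ s)]; last by rewrite eqxx.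
by rewrite -(deg_weight E) /deg E.
Qed.

(** Closed and coclosed sets; they will turn out to be the inversion sets of Weyl group elements. *)
Definition balanced s := forall i j k, e_ k = e_ i + e_ j ->
  (k \in s -> i \in s \/ j \in s) /\ (i \in s -> j \in s -> k \in s).

Lemma deg_eq0 s : deg s = 0%N <-> balanced s.
Proof.
rewrite /deg /degree; split.
  move=> /eqP; rewrite cards_eq0 => /eqP/setP d0 i j k kE.
  have nm t : ~ (fuses s t || fuses t s).
    move=> H; have := d0 t; rewrite !inE basis_edgeE H andbT.
    by case/orP: H => /(fuses_weight L) ->; rewrite eqxx.
  split=> [sk|si sj].
    have [|ni] := boolP (i \in s); first by left.
    have [|nj] := boolP (j \in s); first by right.
    by case: (nm (i |: (j |: s :\ k))); apply/orP; right;
      exact: split_set kE sk ni nj.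
  apply: contrapT => /negP nk; apply: (nm (k |: s :\ i :\ j)).
  by apply/orP; left; exact: fuses_set.
move=> bal; apply/eqP; rewrite cards_eq0; apply/eqP/setP => t; rewrite !inE.
rewrite basis_edgeE; apply/negP => /andP[_] /orP[]/fusesP[i [j [k [kE /setP h1
  /setP h2]]]].
  have := h1 i; have := h1 j; have := h2 k; rewrite !inE !eqxx orbT.
  move=> /andP[ks _] /andP[_ sj] /andP[_ si]; have [_ /(_ si sj)] := bal _ _ _ kE.
  by rewrite (negPf ks).
have := h1 i; have := h1 j; have := h2 k; rewrite !inE !eqxx orbT.
move=> /andP[_ ks] /andP[sj _] /andP[si _]; have [/(_ ks)] := bal _ _ _ kE.
by rewrite (negPf si) (negPf sj) => -[].
Qed.

End Connected.

(** * The Weyl orbit of rho *)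

Section WeylGroup.
Variables (R : realType) (V : vectType R) (S : rootSystem V).
Variable P : positiveSystem S.
Local Notation N := (npos P).
Local Notation e_ := (@proot _ _ _ P).
Local Notation "<< u , v >>" := (dot S u v).
Local Notation f := (pos_fun P).
Local Notation rf := (refl_fun S).
Local Notation W := (@weyl _ _ S).
Implicit Types i j k a b : 'I_N.
Implicit Types s t : {set 'I_N}.
Implicit Types u v x : V.

Lemma reflE x v : refl S x v = rf x v.
Proof. by rewrite lfunE. Qed.

Lemma refl_fun_dot x u v : x != 0 -> <<rf x u, rf x v>> = <<u, v>>.
Proof.
move=> x0; have xx : <<x, x>> != 0 by rewrite gt_eqF // dot_gt0.
rewrite /refl_fun dotBl !dotBr !dotZ !dotZr (dotC S x v).
by field.
Qed.

Lemma refl_funK x : x != 0 -> involutive (rf x).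
Proof.
move=> x0 v; have xx : <<x, x>> != 0 by rewrite gt_eqF // dot_gt0.
rewrite /refl_fun dotBl dotZ -addrA -opprD -scalerDl.
set k := (X in X *: x); suff -> : k = 0 by rewrite scale0r subr0.
by rewrite /k; field.
Qed.

Lemma refl_fun_id x : x != 0 -> rf x x = - x.
Proof.
move=> x0; have xx : <<x, x>> != 0 by rewrite gt_eqF // dot_gt0.
by rewrite /refl_fun mulfK // scaler_nat mulr2n opprD addrA subrr sub0r.
Qed.

Lemma refl_funN x v : rf (- x) v = rf x v.
Proof. by rewrite /refl_fun dotN !dotNr opprK mulrN mulNr scalerN scaleNr
  opprK. Qed.

Definition isom (g : V -> V) := forall u v, <<g u, g v>> = <<u, v>>.

Lemma refl_fun_conj (g : {linear V -> V}) x v :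
  isom g -> g (rf x v) = rf (g x) (g v).
Proof. by move=> gi; rewrite /refl_fun linearB linearZ /= !gi. Qed.

Lemma proot_neq0 i : e_ i != 0.
Proof. exact: root_neq0 (proot_root i). Qed.

Lemma weyl_comp (w1 w2 : 'End(V)) : W w1 -> W w2 -> W (w1 \o w2)%VF.
Proof.
move=> h1 h2; elim: h1 => [|x w rx _ IH]; first by rewrite comp_lfun1l.
by rewrite -comp_lfunA; apply: weyl_refl.
Qed.

Lemma weyl_refl1 x : x \in roots S -> W (refl S x).
Proof.
by move=> rx; have := weyl_refl rx (weyl_one S); rewrite comp_lfun1r.
Qed.

Lemma refl_comp x : x \in roots S -> (refl S x \o refl S x)%VF = \1%VF.
Proof.
move=> rx; apply/lfunP => v; rewrite comp_lfunE !reflE id_lfunE.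
by rewrite refl_funK ?(root_neq0 rx).
Qed.

Lemma weyl_inv (w : 'End(V)) : W w ->
  exists w', [/\ W w', (w' \o w = \1)%VF & (w \o w' = \1)%VF].
Proof.
elim=> [|x w1 rx _ [w' [h1 h2 h3]]].
  by exists \1%VF; split; rewrite ?comp_lfun1l //; exact: weyl_one.
exists (w' \o refl S x)%VF; split.
- by apply: weyl_comp => //; exact: weyl_refl1.
- by rewrite -comp_lfunA [(refl S x \o (_ \o _))%VF]comp_lfunA refl_comp //
  comp_lfun1l.
- by rewrite -comp_lfunA [(w1 \o (_ \o _))%VF]comp_lfunA h3 comp_lfun1l refl_comp.
Qed.

Definition simple i := forall j k, e_ i <> e_ j + e_ k.

Lemma proot_double i k : e_ k <> e_ i + e_ i.
Proof.
move=> kE; have := @roots_reduced _ _ S (e_ i) 2 (proot_root i).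
rewrite scaler_nat mulr2n -kE => /(_ (proot_root k)); case; lra.
Qed.

Lemma proot_neqN i j : e_ i <> - e_ j.
Proof.
move=> E; have := proot_gt0 i; rewrite E linearN oppr_gt0.
by rewrite ltNge ltW // proot_gt0.
Qed.

(** Induction on a bound for the Cartan integer [m b]. If it is at most 0, a nonnegative multiple of
    e_i is added and the image stays positive. Otherwise b = i + k with [m k] smaller by 2, and the
    image is e_j - e_i for some j; were it negative, e_i would be decomposable. *)
Lemma simple_refl i b : simple i -> b != i ->
  exists2 j, rf (e_ i) (e_ b) = e_ j & j != i.
Proof.
move=> si; have ii := proot_dot_gt0 i.
pose m b : R := 2 * <<e_ b, e_ i>> / <<e_ i, e_ i>>.
have [n] : exists n : nat, m b <= n%:R.
  by exists (Num.truncn (m b)).+1; exact/ltW/truncnS_gt.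
have nei a j : rf (e_ i) (e_ a) = e_ j -> j != i.
  move=> aE; apply/eqP => ji; move/(congr1 (rf (e_ i))): aE.
  rewrite ji refl_funK ?refl_fun_id ?proot_neq0 //; exact: proot_neqN.
have base a : m a <= 0 -> a != i -> exists2 j, rf (e_ i) (e_ a) = e_ j & j != i.
  move=> ma ai; have ra := roots_refl (proot_root i) (proot_root a).
  have [|j jE] := pos_root ra (P := P).
    rewrite linearB linearZ /= ltr_pwDl ?proot_gt0 // oppr_ge0.
    by apply: mulr_le0_ge0 ma _; apply/ltW/proot_gt0.
  exists j => //; exact: nei jE.
elim: n b => [|n IH] b mb bi; first exact: base.
have [/base|mb0] := leP (m b) 0; first exact.
have bi0 : 0 < <<e_ b, e_ i>>.
  by move: mb0; rewrite /m pmulr_lgt0 ?invr_gt0 // pmulr_rgt0.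
have [k [kE|kE]] := proot_sub bi bi0; last by case: (si b k).
have ki : k != i by apply/eqP => ki; apply: (@proot_double i b); rewrite kE ki.
have mk : m k <= n%:R.
  have : m b = 2 + m k by rewrite /m kE dotD; field; rewrite gt_eqF.
  by move: mb; rewrite -natr1; lra.
have [j jE ji] := IH k mk ki.
have bE : rf (e_ i) (e_ b) = e_ j - e_ i.
  by rewrite kE linearD /= refl_fun_id ?proot_neq0 // jE addrC.
have [l [lE|lE]] := root_pos_neg P (roots_refl (proot_root i) (proot_root b)).
  by exists l => //; exact: nei lE.
case: (si j l); rewrite -[e_ l]opprK -lE -[X in _ - X]/(rf (e_ i) (e_ b)) bE.
by rewrite opprB addrC subrK.
Qed.

Lemma simple_perm i : simple i -> exists sg : 'I_N -> 'I_N,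
  [/\ involutive sg, sg i = i & forall j, j != i -> rf (e_ i) (e_ j) = e_ (sg j)].
Proof.
(* The reflection negates e_i; the convention [sg i = i] makes [sg] an involution of all indices. *)
move=> si; have ex j : exists l, (j = i -> l = i) /\
    (j != i -> rf (e_ i) (e_ j) = e_ l /\ l != i).
  have [->|ji] := eqVneq j i; first by exists i.
  by have [l h1 h2] := simple_refl si ji; exists l; split=> // /eqP;
    rewrite (negPf ji).
have [sg sgP] := choice ex; exists sg.
have sgi : sg i = i by case: (sgP i) => /(_ erefl).
have sgE j : j != i -> rf (e_ i) (e_ j) = e_ (sg j).
  by move=> ji; case: (sgP j) => _ /(_ ji)[].
split=> // j; have [->|ji] := eqVneq j i; first by rewrite !sgi.
have nsi : sg j != i by case: (sgP j) => _ /(_ ji)[].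
by apply: (@proot_inj _ _ _ P); rewrite -sgE // -sgE // refl_funK // proot_neq0.
Qed.

Lemma refl_rho i : simple i -> rf (e_ i) (rho P) = rho P - e_ i.
Proof.
move=> /simple_perm[sg [sgK sgi sgE]].
rewrite /rho linearZ linear_sum /= (bigD1 i) //= refl_fun_id ?proot_neq0 //.
under eq_bigr do rewrite sgE //.
have -> : \sum_(j | j != i) e_ (sg j) = \sum_(j | j != i) e_ j.
  rewrite [RHS](reindex_inj (inv_inj sgK)) /=; apply: eq_bigl => j.
  have -> : (sg j == i) = (j == i) by rewrite -{1}sgi (inj_eq (inv_inj sgK)).
  by [].
rewrite [in RHS](bigD1 i) //= !scalerDr scalerN addrAC; congr (_ + _).
apply: (addIr (e_ i)); rewrite subrK addrC -[X in X - _]scale1r -scalerBl.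
by congr (_ *: _); field.
Qed.

Lemma balanced_weight s : balanced s -> exists2 w, W w & weight s = w (rho P).
Proof.
have [n] := ubnP #|s|; elim: n s => // n IH s; rewrite ltnS => sn bal.
have [->|[i0 i0s]] := set_0Vmem s.
  by exists \1%VF; [exact: weyl_one|rewrite /weight big_set0 subr0 id_lfunE].
(* A lowest root of s is simple: if it were decomposable, coclosedness would put one of the two
   lower summands into s. *)
pose i := [arg min_(i < i0 in s) f (e_ i)]%O.
have [is_ imin] : i \in s /\ forall j, j \in s -> f (e_ i) <= f (e_ j).
  by rewrite /i; case: Order.TotalTheory.arg_minP.
have si : simple i.
  move=> j k E; have [/(_ is_)[]/imin] := bal _ _ _ E.
    by rewrite E linearD leNgt ltrDl ?proot_gt0.
  by rewrite E linearD leNgt ltrDr ?proot_gt0.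
have [sg [sgK sgi sgE]] := simple_perm si.
have sgI := inv_inj sgK.
have sgni j : (sg j == i) = (j == i) by rewrite -{1}sgi (inj_eq sgI).
pose s' := sg @: (s :\ i).
have s'E j : (j \in s') = (j != i) && (sg j \in s).
  by rewrite -[j in LHS]sgK mem_imset // !inE sgni.
have cs' : (#|s'| < n)%N.
  by rewrite card_imset // (leq_trans _ sn) // (cardsD1 i s) is_.
have bal' : balanced s'.
  move=> a b c cE; have ci : c != i by apply/eqP => ci; apply: (si a b);
    rewrite -ci.
  have rfE := congr1 (rf (e_ i)) cE; rewrite linearD /= in rfE.
  rewrite !s'E ci /=.
  (* For a = i, the relation c = i + b reflects to sg b = i + sg c. Since i lies in s but not in s',
     only the first condition has content, and it follows from s being closed. *)
  have [ai|ai] /= := eqVneq a i.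
    have bi : b != i.
      by apply/eqP => bi; apply: (@proot_double i c); rewrite cE ai bi.
    move: rfE; rewrite ai bi refl_fun_id ?proot_neq0 // !sgE // => E.
    have {}E : e_ (sg b) = e_ i + e_ (sg c) by rewrite E addrA subrr add0r.
    by split=> // cs; right; have [_ /(_ is_ cs)] := bal _ _ _ E.
  have [bi|bi] /= := eqVneq b i.
    move: rfE; rewrite bi refl_fun_id ?proot_neq0 // !sgE // => E.
    have {}E : e_ (sg a) = e_ (sg c) + e_ i by rewrite E subrK.
    by split=> // cs; left; have [_ /(_ cs is_)] := bal _ _ _ E.
  by move: rfE; rewrite !sgE // => /bal.
have [w ww wE] := IH s' cs' bal'.
exists (refl S (e_ i) \o w)%VF; first exact: weyl_refl (proot_root i) ww.
have rs' : rf (e_ i) (\sum_(j in s') e_ j) = \sum_(j in s :\ i) e_ j.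
  rewrite linear_sum big_imset /=; last by move=> ? ? _ _; exact: sgI.
  by apply: eq_bigr => j; rewrite !inE => /andP[ji _]; rewrite sgE ?sgK // sgni.
rewrite comp_lfunE reflE -wE /weight [rf _ _]linearB /= refl_rho // rs'.
by rewrite [in LHS](big_setD1 i is_) /= opprD addrA.
Qed.

(** The functional is f composed with the inverse of w, so its sign at e_i is that of the preimage
    of e_i under w. *)
Lemma weyl_transport (w : 'End(V)) : W w -> exists g : {linear V ->
  R^o}, forall v, g (w v) = f v.
Proof.
elim=> [|x w1 rx _ [g gE]]; first by exists f => v; rewrite id_lfunE.
exists (g \o rf x)%FUN => v.
by rewrite /= comp_lfunE reflE refl_funK ?gE // (root_neq0 rx).
Qed.

Lemma weyl_isom (w : 'End(V)) : W w -> isom w.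
Proof.
elim=> [|x w1 rx _ IH] u v; first by rewrite !id_lfunE.
by rewrite !comp_lfunE !reflE refl_fun_dot ?IH ?(root_neq0 rx).
Qed.

Lemma weyl_injective (w : 'End(V)) : W w -> injective w.
Proof.
move=> ww u v uv; apply/eqP; rewrite -subr_eq0; apply: contraT => /(dot_gt0 S).
by rewrite -(weyl_isom ww) [w (u - v)]linearB /= uv subrr dot0 ltxx.
Qed.

(* 2 g (weight s) = sum of +- g(e_i) is at most the sum of |g(e_i)|, which is
   2 g (w rho); equality fixes all signs. *)
Lemma weight_orbit (w : 'End(V)) (g : {linear V -> R^o}) s : W w ->
  (forall v, g (w v) = f v) -> weight s = w (rho P) ->
  forall i, g (e_ i) != 0 /\ (i \in s) = (g (e_ i) < 0).
Proof.
move=> ww gE sE.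
have ex i : exists j, w (e_ i) = e_ j \/ w (e_ i) = - e_ j.
  exact: root_pos_neg (weyl_root ww (proot_root i)).
(* w permutes the positive roots up to sign, so the values |g(e_i)| are the f(e_i) in another
   order. *)
have [pi piP] := choice ex.
have pi_inj : injective pi.
  move=> i j ij; apply: (@proot_inj _ _ _ P); apply: (weyl_injective ww).
  have nN k l : w (e_ k) = - w (e_ l) -> False.
    by rewrite -linearN => /(weyl_injective ww); exact: proot_neqN.
  case: (piP i) => Ei; case: (piP j) => Ej; rewrite Ei Ej ij //.
    by case: (nN i j); rewrite Ei Ej ij opprK.
  by case: (nN i j); rewrite Ei Ej ij.
have absg i : `|g (e_ (pi i))| = f (e_ i) :> R.
  rewrite -gE; case: (piP i) => E; have := proot_gt0 i; rewrite -gE E.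
    by move/gtr0_norm.
  by rewrite linearN oppr_gt0 => /ltr0_norm.
have sumabs : \sum_i `|g (e_ i)| = \sum_i f (e_ i) :> R.
  by rewrite (reindex_inj pi_inj); apply: eq_bigr => i _; exact: absg.
pose d i : R := `|g (e_ i)| - (if i \in s then - g (e_ i) else g (e_ i)).
have d0 i : 0 <= d i.
  by rewrite subr_ge0; case: ifP => _; rewrite ?ler_norm // ler_normr lexx orbT.
have sumd : \sum_i d i = 0.
  have gs : 2 * g (weight s) = \sum_i f (e_ i) :> R.
    rewrite sE gE /rho linearZ /= linear_sum; apply: mulVKf.
    by rewrite pnatr_eq0.
  have gs' : 2 * g (weight s) = \sum_i (if i \in s then - g (e_ i) else g (e_
    i)) :> R.
    have -> : g (weight s) = 2^-1 * \sum_i g (e_ i) - \sum_(i in s) g (e_ i) :> R.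
      by rewrite /weight linearB /rho linearZ -!linear_sum.
    rewrite mulrBr mulVKf ?pnatr_eq0 // mulr_sumr [X in _ - X]big_mkcond -sumrB.
    by apply: eq_bigr => i _; case: ifP => _;
      rewrite ?subr0 // mulr_natl mulr2n opprD addrA subrr sub0r.
  by rewrite sumrB sumabs -gs gs' subrr.
have dE i : d i = 0.
  have := psumr_eq0P (fun i _ => d0 i) sumd; exact.
move=> i; have gi0 : g (e_ i) != 0.
  have [pi' _ piK] := injF_bij pi_inj.
  by rewrite -[i]piK -normr_eq0 absg gt_eqF ?proot_gt0.
split=> //; have := dE i; rewrite /d; case: ifP => _ /eqP.
  rewrite subr_eq0 => /eqP gE'; apply/esym; rewrite lt_neqAle gi0 /=.
  by rewrite -oppr_ge0 -gE' normr_ge0.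
rewrite subr_eq0 => /eqP gE'; apply/esym/negbTE.
by rewrite -leNgt -gE' normr_ge0.
Qed.

Lemma weight_orbit_balanced (w : 'End(V)) s :
  W w -> weight s = w (rho P) -> balanced s.
Proof.
move=> ww sE; have [g gE] := weyl_transport ww.
have H := weight_orbit ww gE sE.
move=> i j k kE; rewrite !(proj2 (H _)) kE linearD; have [gi _] := H i;
  have [gj _] := H j.
split=> [ij|i0 j0]; last by rewrite -oppr_gt0 opprD addr_gt0 ?oppr_gt0.
have [i0|i0] := ltP (g (e_ i)) 0; first by left.
right; rewrite ltNge; apply/negP => j0; move: ij.
by rewrite ltNge addr_ge0.
Qed.

(** * Words in simple reflections and the exchange property *)

Fixpoint word_act (l : seq 'I_N) v :=
  if l is i :: l' then rf (e_ i) (word_act l' v) else v.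

Definition simple_word (l : seq 'I_N) := forall i, i \in l -> simple i.

Lemma word_act_cat l1 l2 v : word_act (l1 ++ l2) v = word_act l1 (word_act l2 v).
Proof. by elim: l1 => //= i l1 ->. Qed.

Lemma word_weyl l : exists2 w, W w & forall v, w v = word_act l v.
Proof.
elim: l => [|i l [w ww wE]]; first by exists \1%VF; [exact: weyl_one|move=> v;
  rewrite id_lfunE].
exists (refl S (e_ i) \o w)%VF; first exact: weyl_refl (proot_root i) ww.
by move=> v; rewrite comp_lfunE reflE wE.
Qed.

Lemma word_act_proot l i : exists j, word_act l (e_ i) = e_ j \/ word_act l (e_
  i) = - e_ j.
Proof.
have [w ww wE] := word_weyl l; rewrite -wE; apply: root_pos_neg.
exact: weyl_root ww (proot_root i).
Qed.

Lemma word_act_refl l i v :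
  word_act l (rf (e_ i) v) = rf (word_act l (e_ i)) (word_act l v).
Proof.
have [w ww wE] := word_weyl l; rewrite -!wE.
exact: (refl_fun_conj _ _ (weyl_isom ww)).
Qed.

(** Read from the right, the image of e_i turns negative at some letter a. A simple reflection makes
    only its own root negative, so the image just before is e_a. The reflection in i crosses that
    part of the word as the reflection in a and cancels the letter. *)
Lemma word_exchange l i j : simple_word l -> simple i ->
  word_act l (e_ i) = - e_ j ->
  exists l', [/\ simple_word l', (size l' < size l)%N &
    forall v, word_act l (rf (e_ i) v) = word_act l' v].
Proof.
move=> + si; elim: l j => [|a l IH] j sl /=; first by move/proot_neqN.
have sa : simple a by apply: sl; rewrite mem_head.
have {}sl : simple_word l by move=> b bl; apply: sl; rewrite inE bl orbT.
have [b [lE|lE]] := word_act_proot l i; last first.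
  move=> _; have [l' [h1 h2 h3]] := IH b sl lE.
  exists (a :: l'); split=> [c||v] //=; last by rewrite h3.
  by rewrite inE => /orP[/eqP->//|/h1].
have [ba|ba] := eqVneq b a; last first.
  by have [c cE _] := simple_refl sa ba; rewrite lE cE => /proot_neqN.
move=> _; exists l; split=> // v.
by rewrite word_act_refl lE ba refl_funK // proot_neq0.
Qed.

(** Without its last letter i the word sends e_i to a negative root, so the exchange property
    rewrites the whole word with at least two letters fewer. *)
Lemma word_fix l : simple_word l ->
  (forall i, exists j, word_act l (e_ i) = e_ j) ->
  forall v, word_act l v = v.
Proof.
have [n] := ubnP (size l); elim: n l => // n IH l.
case/lastP: l => // l i; rewrite size_rcons !ltnS -cats1 => ln sl fixl.
have si : simple i by apply: sl; rewrite mem_cat mem_head orbT.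
have {}sl : simple_word l by move=> b bl; apply: sl; rewrite mem_cat bl.
have [j jE] := fixl i.
have lE : word_act l (e_ i) = - e_ j.
  have [w ww wE] := word_weyl l; rewrite -jE word_act_cat /= refl_fun_id
    ?proot_neq0 //.
  by rewrite -!wE linearN opprK.
have [l' [h1 h2 h3]] := word_exchange sl si lE.
have l'E v : word_act (l ++ [:: i]) v = word_act l' v by rewrite word_act_cat h3.
move=> v; rewrite l'E; apply: IH => //; first exact: ltn_trans h2 ln.
by move=> k; have [m mE] := fixl k; exists m; rewrite -l'E.
Qed.

(** Induction on the number of positive roots lower than b. The lowest i with (b,i) > 0 is simple,
    since a summand of i would also pair positively with b. Its reflection lowers b to some c, and
    r_b = r_i r_c r_i. *)
Lemma refl_word b : exists2 l, simple_word l & forall v, rf (e_ b) v = word_act l v.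
Proof.
have [n] := ubnP #|[set j | f (e_ j) < f (e_ b)]|; elim: n b => // n IH b;
  rewrite ltnS => bn.
pose i := [arg min_(i < b | 0 < <<e_ b, e_ i>>) f (e_ i)]%O.
have [bi imin] : 0 < <<e_ b, e_ i>> /\
    forall j, 0 < <<e_ b, e_ j>> -> f (e_ i) <= f (e_ j).
  rewrite /i; case: Order.TotalTheory.arg_minP => //; exact: proot_dot_gt0.
have si : simple i.
  move=> j k E; have : 0 < <<e_ b, e_ j>> \/ 0 < <<e_ b, e_ k>>.
    have [|bj] := ltP 0 <<e_ b, e_ j>>; first by left.
    by right; move: bi; rewrite E dotDr; lra.
  by case=> /imin; rewrite E linearD leNgt ?ltrDl ?ltrDr proot_gt0.
have [bi'|bi'] := eqVneq b i.
  exists [:: b] => //= j; rewrite inE => /eqP->; by rewrite bi'.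
have [c cE _] := simple_refl si bi'.
have cb : f (e_ c) < f (e_ b).
  rewrite -cE linearB linearZ /= gtrBl.
  by apply: mulr_gt0 (proot_gt0 i); rewrite divr_gt0 ?proot_dot_gt0 // mulr_gt0.
have [l sl lE] : exists2 l, simple_word l & forall v, rf (e_ c) v = word_act l v.
  apply: IH; apply: leq_trans bn; apply: proper_card; apply/properP; split.
    by apply/subsetP => j; rewrite !inE => /lt_trans->.
  by exists c; rewrite !inE ?ltxx.
exists (i :: l ++ [:: i]) => [j|v /=].
  by rewrite inE mem_cat inE => /or3P[/eqP->|/sl|/eqP->].
rewrite word_act_cat /= -lE -cE.
rewrite (refl_fun_conj _ _ (g := rf (e_ i))).
  by rewrite /= !refl_funK ?proot_neq0.
by move=> ? ?; rewrite refl_fun_dot ?proot_neq0.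
Qed.

Lemma weyl_word (w : 'End(V)) : W w ->
  exists2 l, simple_word l & forall v, w v = word_act l v.
Proof.
elim=> [|x w1 rx _ [l sl lE]]; first by exists [::] => // v; rewrite id_lfunE.
have [i xE] := root_pos_neg P rx; have [l1 sl1 l1E] := refl_word i.
exists (l1 ++ l) => [j|v]; first by rewrite mem_cat => /orP[/sl1|/sl].
rewrite word_act_cat -lE comp_lfunE reflE -l1E.
by case: xE => ->; rewrite ?refl_funN.
Qed.

(** As rho is the weight of the empty set, [weight_orbit] shows that w makes no positive root
    negative, and [word_fix] applies. *)
Lemma weyl_fix_rho (w : 'End(V)) : W w -> w (rho P) = rho P -> w = \1%VF.
Proof.
move=> ww wrho; have [l sl lE] := weyl_word ww.
apply/lfunP => v; rewrite id_lfunE lE; apply: word_fix => // i.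
have [j] := word_act_proot l i; rewrite -lE => -[E|E]; first by exists j.
have [g gE] := weyl_transport ww.
have sE : weight (P := P) set0 = w (rho P) by rewrite wrho /weight big_set0 subr0.
have [gj] := weight_orbit ww gE sE j; rewrite inE => /esym/negbT;
  rewrite -leNgt => gj0.
have := proot_gt0 i; rewrite -gE E linearN oppr_gt0 => gjn.
by move: gj0; rewrite leNgt gjn.
Qed.

Lemma weyl_rho_inj (w1 w2 : 'End(V)) : W w1 -> W w2 ->
  w1 (rho P) = w2 (rho P) -> w1 = w2.
Proof.
move=> h1 h2 E; have [w' [h3 w'1 w1']] := weyl_inv h1.
have : (w' \o w2 = \1)%VF.
  apply: weyl_fix_rho; first exact: weyl_comp.
  by rewrite comp_lfunE -E -comp_lfunE w'1 id_lfunE.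
by move/(congr1 (comp_lfun w1));
  rewrite comp_lfunA w1' comp_lfun1l comp_lfun1r => ->.
Qed.

End WeylGroup.

(** * Homology and cohomology *)

Section Chains.
Variables (R : realType) (V : vectType R) (S : rootSystem V).
Variables (P : positiveSystem S) (L : rootLie P) (F : fieldType).
Local Notation N := (npos P).
Local Notation chain := (chain P F).
Implicit Types (A B : {pred V}) (D : pred nat) (n : nat).
Implicit Types (s t : {set 'I_N}) (u v z : chain).

Lemma chain_expand u : u = \sum_s u s *: chain_basis F s.
Proof.
apply/ffunP => t; rewrite sum_ffunE (bigD1 t) //= big1 ?addr0 => [|s st].
  by rewrite !ffunE eqxx mulr1n [RHS]mulr1.
by rewrite !ffunE eq_sym (negPf st) [LHS]mulr0.
Qed.

Definition coord_fun s (u : chain) : F^o := u s.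
Lemma coord_fun_linear s : linear (coord_fun s).
Proof. by move=> k u v; rewrite /coord_fun !ffunE. Qed.
HB.instance Definition _ s :=
  GRing.isLinear.Build F chain F^o _ (coord_fun s) (coord_fun_linear s).

Lemma chainsP A D u :
  reflect (forall s, u s != 0 -> weight s \in A /\ D #|s|) (u \in chains P F A D).
Proof.
apply: (iffP idP) => [uC s us|H].
  apply: contrapT => ns; case/eqP: us.
  suff : (chains P F A D <= lker (linfun (coord_fun s)))%VS.
    by move/subvP/(_ _ uC); rewrite memv_ker lfunE => /eqP.
  apply/span_subvP => v /imageP[t]; rewrite inE => /andP[tA tD] ->.
  rewrite memv_ker lfunE /= /coord_fun ffunE.
  by have [st|//] := eqVneq s t; case: ns; rewrite st.
rewrite [u]chain_expand; apply: memv_suml => s _.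
have [->|us] := eqVneq (u s) 0; first by rewrite scale0r mem0v.
have [sA sD] := H s us.
by apply/memvZ/memv_span/image_f; rewrite inE sA.
Qed.

(** Projection onto the weights in A. It commutes with both differentials, which is how cycles and
    boundaries split by weight. *)
Definition restrict A u : chain := [ffun s => if weight s \in A then u s else 0].

Lemma restrict_chains A B D u : u \in chains P F B D ->
  restrict A u \in chains P F A D.
Proof.
move/chainsP => H; apply/chainsP => s; rewrite ffunE; case: ifP; rewrite ?eqxx //.
by move=> sA /H[].
Qed.

Lemma chains_sub A B D : {subset A <= B} -> (chains P F A D <= chains P F B D)%VS.
Proof.
move=> AB; apply/subvP => u /chainsP H; apply/chainsP => s /H[h1 h2].
by split; first exact: AB.
Qed.

(* Applied to T = d, T' = delta, and to T = delta, T' = d with M transposed. *)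
Section Complex.
Variables (T T' : 'End(chain)) (M : {set 'I_N} -> {set 'I_N} -> F).
Variables (n : nat) (D : pred nat).
Hypothesis TE : forall u t, T u t = \sum_s u s * M s t.
Hypothesis T'E : forall u s, T' u s = \sum_t u t * M s t.
Hypothesis M_weight : forall s t, M s t != 0 -> weight s = weight t.
Hypothesis M_card : forall s t, M s t != 0 -> #|t| = n -> D #|s|.
Hypothesis M_deg : forall s t, M s t != 0 -> deg s = deg t.
Hypothesis M_deg_gt0 : forall s t, M s t != 0 -> (0 < deg s)%N.
Hypothesis lapE : forall u s, (T (T' u) + T' (T u)) s = (deg s)%:R * u s.

Definition cyc A := (chains P F A (pred1 n) :&: lker T)%VS.
Definition bnd A := (T @: chains P F A D)%VS.

Lemma cyc_sub A B : {subset A <= B} -> (cyc A <= cyc B)%VS.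
Proof. by move=> AB; apply: capvS => //; exact: chains_sub. Qed.

Lemma bnd_sub A B : {subset A <= B} -> (bnd A <= bnd B)%VS.
Proof. by move=> AB; apply: limgS; exact: chains_sub. Qed.

Lemma restrict_T A u : T (restrict A u) = restrict A (T u).
Proof.
apply/ffunP => t; rewrite TE ffunE TE; case: ifP => tA.
  apply: eq_bigr => s _; rewrite ffunE; case: ifP => sA //.
  have [->|/M_weight st] := eqVneq (M s t) 0; first by rewrite !mulr0.
  by rewrite st tA in sA.
apply: big1 => s _; rewrite ffunE; case: ifP => sA; rewrite ?mul0r //.
have [->|/M_weight st] := eqVneq (M s t) 0; first by rewrite mulr0.
by rewrite -st sA in tA.
Qed.

Lemma restrict_cyc A B z : z \in cyc B -> restrict A z \in cyc A.
Proof.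
rewrite !memv_cap !memv_ker => /andP[zB /eqP Tz].
rewrite (restrict_chains _ zB) restrict_T Tz.
by apply/eqP/ffunP => s; rewrite !ffunE; case: ifP.
Qed.

Lemma restrict_bnd A B z : z \in bnd B -> restrict A z \in bnd A.
Proof.
case/memv_imgP => u uB ->; rewrite -restrict_T.
by apply/memv_img; exact: restrict_chains uB.
Qed.

(** Entries of T join only sets of equal degree, so y = z / deg is again a cycle, and the Laplacian
    gives z = T (T' y). *)
Lemma cyc_bnd A z : (forall s, weight s \in A -> (deg s)%:R != 0 :> F) ->
  z \in cyc A -> z \in bnd A.
Proof.
move=> dA; rewrite memv_cap memv_ker => /andP[/chainsP zA /eqP Tz].
(* Where deg vanishes in F, so does z, and the convention x / 0 = 0 does no harm. *)
pose y : chain := [ffun s => z s / (deg s)%:R].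
have Ty : T y = 0.
  apply/ffunP => t; rewrite TE.
  transitivity (T z t / (deg t)%:R); last by rewrite Tz !ffunE mul0r.
  rewrite TE mulr_suml; apply: eq_bigr => s _; rewrite ffunE.
  have [->|/M_deg ->] := eqVneq (M s t) 0; first by rewrite !(mulr0, mul0r).
  by rewrite mulrAC.
have -> : z = T (T' y).
  apply/ffunP => s; have := lapE y s; rewrite Ty linear0 addr0 => ->.
  rewrite ffunE; have [->|zs] := eqVneq (z s) 0; first by rewrite mul0r mulr0.
  by rewrite mulrC divfK //; case: (zA s zs) => /dA.
apply/memv_img/chainsP => s T's.
have [t /andP[yt Mst]] : exists t, (y t != 0) && (M s t != 0).
  apply: contrapT => nt; case/eqP: T's; rewrite T'E big1 // => t _; apply/eqP.
  by rewrite mulf_eq0; apply: contrapT => H; apply: nt; exists t;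
    rewrite -negb_or; apply/negP.
have zt : z t != 0 by apply: contraNneq yt => zt; rewrite ffunE zt mul0r.
have [tA /eqP tn] := zA t zt.
by split; [rewrite (M_weight Mst)|exact: M_card Mst tn].
Qed.

Lemma M_deg0 s t : deg s = 0%N \/ deg t = 0%N -> M s t = 0.
Proof.
move=> H; apply/eqP; apply: contraT => Mst; have := M_deg_gt0 Mst.
by case: H => H; [rewrite H|rewrite (M_deg Mst) H].
Qed.

Lemma chains_ker A D' : (forall s, weight s \in A -> deg s = 0%N) ->
  (chains P F A D' <= lker T)%VS.
Proof.
move=> dA; apply/subvP => u /chainsP uA; rewrite memv_ker; apply/eqP/ffunP => t.
rewrite TE ffunE big1 // => s _; have [->|/uA[/dA ds _]] := eqVneq (u s) 0.
  by rewrite mul0r.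
by rewrite M_deg0 ?mulr0 //; left.
Qed.

Lemma bnd0 A : (forall s, weight s \in A -> deg s = 0%N) -> bnd A = 0%VS.
Proof. by move=> /(chains_ker D); rewrite lkerE => /eqP. Qed.

(** Sets of degree 0 meet no nonzero entry of T, so every chain is a cycle and only 0 is a
    boundary. *)
Lemma class_iso A : (forall s, weight s \in A -> deg s = 0%N) ->
  iso (linfun (sqclass (cyc A) (bnd A) \o vsval) :
    'Hom(subvs_of (chains P F A (pred1 n)), subvs_of (subquot (cyc A) (bnd A)))).
Proof.
move=> dA; have cA : cyc A = chains P F A (pred1 n).
  by apply/capv_idPl; exact: chains_ker.
split.
  apply/eqP; rewrite -subv0; apply/subvP => v; rewrite memv_ker lfunE /=.
  rewrite sqclass_eq0 ?cA ?subvsP // bnd0 // !memv0 => v0.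
  by rewrite -(inj_eq val_inj).
apply/vspaceP => h; rewrite memvf; have [z zA ->] := sqclass_surj h.
rewrite {1}cA in zA; apply/memv_imgP; exists (vsproj _ z); first exact: memvf.
by rewrite [RHS]lfunE /= vsprojK.
Qed.

Lemma quot_eq0 A (h : subvs_of (subquot (cyc A) (bnd A))) :
  (forall s, weight s \in A -> (deg s)%:R != 0 :> F) -> h = 0.
Proof.
move=> dA; have [z zA ->] := sqclass_surj h.
by apply/eqP; rewrite sqclass_eq0 // cyc_bnd.
Qed.

Hypothesis F0 : [pchar F] =i pred0.
Local Notation wr w := (weyl_act w (rho P)).
Local Notation incl w :=
  (sqmap (cyc (pred1 (wr w))) (bnd (pred1 (wr w))) (cyc predT) (bnd predT)).

Lemma weyl_act_inj (w w' : weylGroup S) : wr w = wr w' -> w = w'.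
Proof.
by move=> E; apply: val_inj; apply: weyl_rho_inj E; apply/weyl_enumP/valP.
Qed.

(** Distinct w give distinct weights w rho, so restricting the sum to one of them recovers [z w];
    and restriction preserves boundaries. *)
Lemma orbit_bnd (z : weylGroup S -> chain) :
  (forall w : weylGroup S, z w \in cyc (pred1 (wr w))) ->
    \sum_w z w \in bnd predT ->
  forall w : weylGroup S, z w \in bnd (pred1 (wr w)).
Proof.
move=> zc /restrict_bnd zb w; have := zb (pred1 (wr w)).
suff -> : restrict (pred1 (wr w)) (\sum_w z w) = z w by [].
have zn (w' : weylGroup S) s : z w' s != 0 -> weight s = wr w'.
  by move: (zc w'); rewrite memv_cap => /andP[/chainsP H _] /H[/eqP].
apply/ffunP => s; rewrite ffunE sum_ffunE inE; case: eqP => [sw|nsw].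
  rewrite (bigD1 w) //= big1 ?addr0 // => w' ww'; apply/eqP.
  by apply: contraNT ww' => /zn; rewrite sw => /weyl_act_inj->.
by apply/esym/eqP; apply: contraT => /zn.
Qed.

Lemma incl_class (w : weylGroup S) z : z \in cyc (pred1 (wr w)) ->
  incl w (sqclass (cyc (pred1 (wr w))) (bnd (pred1 (wr w))) z) =
  sqclass (cyc predT) (bnd predT) z.
Proof. by move=> zc; apply: sqmap_class => //; [exact: cyc_sub|exact: bnd_sub]. Qed.

Lemma deg_char0 s : (forall w : weylGroup S, weight s != wr w) ->
  (deg s)%:R != 0 :> F.
Proof.
move=> ns; rewrite (pcharf0P F).1 //;
  apply/eqP => /(deg_eq0 L)/balanced_weight[w ww sw].
have wi : w \in weyl_enum S by apply/weyl_enumP.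
by have := ns (SeqSub wi); rewrite /weyl_act /= sw eqxx.
Qed.

Lemma restrict_split z : z =
  restrict [pred x : V | [forall w : weylGroup S, x != wr w]] z +
  \sum_(w : weylGroup S) restrict (pred1 (wr w)) z.
Proof.
apply/ffunP => s; rewrite ffunE sum_ffunE ffunE inE.
under eq_bigr => w _ do rewrite ffunE inE.
case: ifP => [/forallP nA|/negbT].
  by rewrite big1 ?addr0 // => w _; rewrite (negPf (nA w)).
rewrite negb_forall => /existsP[w]; rewrite negbK => /eqP sw.
rewrite add0r (bigD1 w) //= sw eqxx big1 ?addr0 // => w' ww'.
by case: eqP => // /weyl_act_inj E; rewrite E eqxx in ww'.
Qed.

(** Injectivity and independence both come from [orbit_bnd], the former with a family supported at
    one w. For spanning, the part of a cycle off the orbit of rho is a boundary, as its degrees are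
    nonzero in characteristic 0. *)
Lemma incl_direct_sum : direct_sum (fun w : weylGroup S => incl w).
Proof.
have cycT A z : z \in cyc A -> z \in cyc predT by apply/subvP/cyc_sub.
split.
- move=> w; apply/eqP; rewrite -subv0; apply/subvP => h; rewrite memv_ker memv0.
  have [z zc ->] := sqclass_surj h.
  rewrite incl_class // sqclass_eq0 ?(cycT _ _ zc) // sqclass_eq0 // => zb.
  pose z' w' : chain := if w' == w then z else 0.
  have := @orbit_bnd z' _ _ w; rewrite /z' eqxx; apply.
    by move=> w'; case: eqP => [->|_]; rewrite ?mem0v.
  by rewrite (bigD1 w) //= eqxx big1 ?addr0 // => w' /negPf->.
- apply/directv_sum_independent => us usP us0 w _.
  have ex (w' : weylGroup S) : exists z, z \in cyc (pred1 (wr w')) /\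
      us w' = sqclass (cyc predT) (bnd predT) z.
    have /memv_imgP[h _ ->] := usP w' isT.
    by have [z zc ->] := sqclass_surj h; exists z; rewrite incl_class.
  have [z zP] := choice ex.
  have [zc zE] : (forall w' : weylGroup S, z w' \in cyc (pred1 (wr w'))) /\
      forall w', us w' = sqclass (cyc predT) (bnd predT) (z w').
    by split=> w'; case: (zP w').
  rewrite zE; apply/eqP; rewrite sqclass_eq0 ?(cycT _ _ (zc w)) //.
  apply: (subvP (bnd_sub _)) (orbit_bnd zc _ w) => //.
  rewrite -(sqclass_eq0 (Z := cyc predT)); last by apply: memv_suml => w' _;
    exact: cycT (zc w').
  by apply/eqP; rewrite linear_sum /= -[RHS]us0; apply: eq_bigr => w' _; rewrite zE.
- apply/vspaceP => h; rewrite memvf; have [z zc ->] := sqclass_surj h.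
  pose A := [pred x : V | [forall w : weylGroup S, x != wr w]].
  have z0 : sqclass (cyc predT) (bnd predT) (restrict A z) = 0.
    have rc := restrict_cyc A zc.
    apply/eqP; rewrite sqclass_eq0 ?(cycT _ _ rc) //.
    apply: (subvP (bnd_sub _)) (cyc_bnd _ rc) => // s; rewrite inE => /forallP.
    exact: deg_char0.
  rewrite {1}[z]restrict_split linearD /= z0 add0r linear_sum /=;
    apply: memv_sumr => w _.
  rewrite -(@incl_class w); last exact: restrict_cyc zc.
  by apply/memv_img/memvf.
Qed.

End Complex.
End Chains.

(** * Specialization to d and to delta *)

Section HomologyInstances.
Variables (R : realType) (V : vectType R) (S : rootSystem V).
Variables (P : positiveSystem S) (L : rootLie P) (F : fieldType).
Local Notation N := (npos P).
Implicit Types (s t : {set 'I_N}) (u : chain P F).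

Definition dmat s t : F := (dcoef (lbr L) s t)%:~R.

Lemma diffE u t : diff L F u t = \sum_s u s * dmat s t.
Proof. by rewrite lfunE ffunE. Qed.

Lemma codiffE u s : codiff L F u s = \sum_t u t * dmat s t.
Proof. by rewrite lfunE ffunE. Qed.

Lemma dmat_fuses s t : dmat s t != 0 -> fuses s t.
Proof. by rewrite -(dcoef_neq0 L); apply: contraNneq => E; rewrite /dmat E. Qed.

(** The integral identity [dcoef_lap] is transported to F, whatever its characteristic. *)
Lemma laplacianE u s :
  (diff L F (codiff L F u) + codiff L F (diff L F u)) s = (deg s)%:R * u s.
Proof.
rewrite ffunE diffE codiffE.
transitivity (\sum_v u v * (if v == s then (deg v)%:R else 0)).
  rewrite -big_split /=.
  under eq_bigr => t _ do rewrite codiffE diffE !mulr_suml -big_split /=.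
  rewrite exchange_big; apply: eq_bigr => v _.
  transitivity (u v * (\sum_t (dcoef (lbr L) t v * dcoef (lbr L) t s +
      dcoef (lbr L) v t * dcoef (lbr L) s t))%:~R).
    rewrite rmorph_sum mulr_sumr; apply: eq_bigr => t _ /=.
    by rewrite rmorphD !rmorphM /= mulrDr !mulrA.
  by rewrite dcoef_lap; case: eqP => _; rewrite ?mulr0z ?natz ?pmulrn.
rewrite (bigD1 s) //= eqxx big1 => [|v /negPf->]; last by rewrite mulr0.
by rewrite addr0 [LHS]mulrC.
Qed.

Lemma dmat_weight s t : dmat s t != 0 -> weight s = weight t.
Proof. by move/dmat_fuses/(fuses_weight L). Qed.

Lemma dmat_card s t : dmat s t != 0 -> #|s| = #|t|.+1.
Proof. by move/dmat_fuses/(fuses_card L). Qed.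

Lemma dmat_deg s t : dmat s t != 0 -> deg s = deg t.
Proof. by move/dmat_fuses/(deg_fuses L). Qed.

Lemma dmat_deg_gt0 s t : dmat s t != 0 -> (0 < deg s)%N.
Proof.
move=> /dmat_fuses st; rewrite lt0n cards_eq0; apply/set0Pn; exists t.
by rewrite inE -(fuses_weight L st) eqxx basis_edgeE st.
Qed.

Lemma dmat_card_diff n s t : dmat s t != 0 -> #|t| = n -> pred1 n.+1 #|s|.
Proof. by move=> /dmat_card-> ->; rewrite /= eqxx. Qed.

Lemma codiff_laplacianE u s :
  (codiff L F (diff L F u) + diff L F (codiff L F u)) s = (deg s)%:R * u s.
Proof. by rewrite addrC laplacianE. Qed.

Lemma tr_dmat_weight s t : dmat t s != 0 -> weight s = weight t.
Proof. by move/dmat_weight. Qed.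

Lemma tr_dmat_card n s t : dmat t s != 0 -> #|t| = n -> #|s|.+1 == n.
Proof. by move=> /dmat_card-> ->. Qed.

Lemma tr_dmat_deg s t : dmat t s != 0 -> deg s = deg t.
Proof. by move/dmat_deg. Qed.

Lemma tr_dmat_deg_gt0 s t : dmat t s != 0 -> (0 < deg s)%N.
Proof. by move=> st; rewrite -(dmat_deg st) (dmat_deg_gt0 st). Qed.

Lemma deg_orbit (w : weylGroup S) s :
  weight s \in pred1 (weyl_act w (rho P)) -> deg s = 0%N.
Proof.
move/eqP => sw; apply/(deg_eq0 L)/(weight_orbit_balanced _ sw).
exact/weyl_enumP/valP.
Qed.

Variable n : nat.

Lemma homology_eq0 A (h : homology L F A n) :
  (forall s, weight s \in A -> (deg s)%:R != 0 :> F) -> h = 0.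
Proof.
exact: (quot_eq0 diffE codiffE dmat_weight (@dmat_card_diff n) dmat_deg laplacianE).
Qed.

Lemma cohomology_eq0 A (h : cohomology L F A n) :
  (forall s, weight s \in A -> (deg s)%:R != 0 :> F) -> h = 0.
Proof.
exact: (quot_eq0 (M := fun s t => dmat t s) codiffE diffE tr_dmat_weight
  (@tr_dmat_card n) tr_dmat_deg codiff_laplacianE).
Qed.

Lemma homology_direct_sum : [pchar F] =i pred0 ->
  direct_sum (fun w : weylGroup S => homology_incl L F (weyl_act w (rho P)) n).
Proof.
exact: (incl_direct_sum L diffE codiffE dmat_weight (@dmat_card_diff n)
  dmat_deg laplacianE).
Qed.

Lemma cohomology_direct_sum : [pchar F] =i pred0 ->
  direct_sum (fun w : weylGroup S => cohomology_incl L F (weyl_act w (rho P)) n).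
Proof.
exact: (incl_direct_sum L (M := fun s t => dmat t s) codiffE diffE tr_dmat_weight
  (@tr_dmat_card n) tr_dmat_deg codiff_laplacianE).
Qed.

Lemma homology_orbit (w : weylGroup S) :
  (chains P F (pred1 (weyl_act w (rho P))) (pred1 n) <= lker (diff L F))%VS /\
  iso (homology_class L F (weyl_act w (rho P)) n).
Proof.
split; first exact: (chains_ker diffE dmat_deg dmat_deg_gt0 _ (@deg_orbit w)).
exact: (class_iso _ _ diffE dmat_deg dmat_deg_gt0 (@deg_orbit w)).
Qed.

Lemma cohomology_orbit (w : weylGroup S) :
  (chains P F (pred1 (weyl_act w (rho P))) (pred1 n) <= lker (codiff L F))%VS /\
  iso (cohomology_class L F (weyl_act w (rho P)) n).
Proof.
pose M s t := dmat t s; split.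
  exact: (chains_ker (M := M) codiffE tr_dmat_deg tr_dmat_deg_gt0 _ (@deg_orbit w)).
exact: (class_iso (M := M) _ _ codiffE tr_dmat_deg tr_dmat_deg_gt0 (@deg_orbit w)).
Qed.

End HomologyInstances.

Theorem theorem6p7 (R : realType) (V : vectType R) (S : rootSystem V)
    (P : positiveSystem S) (L : rootLie P) :
  (forall F0 : fieldType, [pchar F0] =i pred0 -> forall n : nat,
     (direct_sum (fun w : weylGroup S =>
          homology_incl L F0 (weyl_act w (rho P)) n) /\
      forall w : weylGroup S,
        (chains P F0 (pred1 (weyl_act w (rho P))) (pred1 n)
           <= lker (diff L F0))%VS /\
        iso (homology_class L F0 (weyl_act w (rho P)) n)) /\
     (direct_sum (fun w : weylGroup S =>
          cohomology_incl L F0 (weyl_act w (rho P)) n) /\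
      forall w : weylGroup S,
        (chains P F0 (pred1 (weyl_act w (rho P))) (pred1 n)
           <= lker (codiff L F0))%VS /\
        iso (cohomology_class L F0 (weyl_act w (rho P)) n))) /\
  (forall (p : nat) (Fp : fieldType), p \in [pchar Fp] ->
   forall alpha : V, (exists s : {set 'I_(npos P)}, weight s = alpha) ->
     (rank P alpha <> 0 %[mod p])%N ->
   forall n : nat,
     (forall h : homology L Fp (pred1 alpha) n, h = 0) /\
     (forall h : cohomology L Fp (pred1 alpha) n, h = 0)).
Proof.
split=> [F0 char0 n|p Fp charp alpha _ rk n].
  split; split.
  - exact: homology_direct_sum.
  - exact: homology_orbit.
  - exact: cohomology_direct_sum.
  - exact: cohomology_orbit.
(* [rank_weight] carries the rank, read off one vertex, to every set of weight alpha; p being the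
   characteristic, the incongruence becomes non-vanishing in Fp. *)
have dp (s : {set 'I_(npos P)}) : weight s \in pred1 alpha -> (deg s)%:R != 0 :> Fp.
  move/eqP => sa; rewrite -(rank_weight L) sa -(dvdn_pcharf charp) /dvdn.
  by apply/eqP; rewrite -(mod0n p).
by split=> h; [exact: homology_eq0|exact: cohomology_eq0].
Qed.
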